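(* Let $(M^n,g)$, $n\ge3$, be a nontrivial gradient Einstein-type manifold with potential function $f$ and both $\beta$ and $\mu$ nonzero; that is, there are smooth functions $f,\lambda:M^n\to\mathbb{R}$ with $f$ nonconstant and constants $\alpha,\beta,\mu,\rho\in\mathbb{R}$ with $\beta,\mu\ne0$ such that $$\alpha\, Ric+\beta\,\nabla^2 f+\mu\, df\otimes df=(\rho S+\lambda)g .$$ If $(M^n,g)$ is an Einstein manifold, then the positive smooth function $u=e^{\frac{\mu}{\beta}f}$ provides a special concircular field on $(M^n,g)$. More precisely, there is a constant $c\in\mathbb{R}$ such that $u$ satisfies the equation $$\nabla^2u=(-ku+b)g$$ with constant coefficients $k=\frac{S}{n(n-1)}$ and $b=\frac{\mu}{\beta}c$.
   Context: All manifolds $(M^n,g)$ are connected smooth Riemannian manifolds of dimension $n\ge3$; $Ric$ and $S$ denote the Ricci tensor and the scalar curvature, and $\nabla^2$ the Hessian. $(M^n,g)$ is a gradient Einstein-type manifold with potential function $f$ if there are smooth functions $f,\lambda$ on $M$ and real constants $\alpha,\beta,\mu,\rho$ with $(\alpha,\beta,\mu)\ne(0,0,0)$ such that $\alpha Ric+\beta\nabla^2 f+\mu\,df\otimes df=(\rho S+\lambda)g$. The structure is trivial if $f$ is constant, and nontrivial otherwise. A manifold is Einstein if $Ric=\frac{S}{n}g$ (with $S$ then constant, as $n\ge3$). A (nonconstant) smooth function $u$ provides a special concircular field if $\nabla^2u=(-ku+b)g$ for some constants $k,b$. *)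

(* Defs.v *)
(* Smooth manifolds and their tensor fields are described by components in
   the charts of an atlas; an equation between tensor fields is the equality
   of components at every point of every chart.  Inside a chart a covariant
   2-tensor field is a matrix-valued function of the coordinates, which form
   a row vector x : 'rV[R]_n. *)
From HB Require Import structures.
From mathcomp Require Import all_boot all_order all_algebra.
From mathcomp Require Import all_classical all_reals all_analysis.
Import Order.TTheory GRing.Theory Num.Theory.
Import numFieldNormedType.Exports.
Set Implicit Arguments.
Unset Strict Implicit.
Unset Printing Implicit Defensive.
Local Open Scope classical_set_scope.
Local Open Scope ring_scope.

Section Coordinates.
Variables (R : realType) (n : nat).
Implicit Types (F : 'rV[R]_n -> R) (x : 'rV[R]_n) (g : 'rV[R]_n -> 'M[R]_n).

Definition pd (i : 'I_n) F x : R := 'D_(delta_mx 0 i) F x.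

(* C^oo on U: partial derivatives of all orders exist and are (Frechet)
   differentiable at the points of U.  U is open in all uses below, so only
   the values of F on U matter. *)
Definition smooth_on (U : set 'rV[R]_n) F : Prop :=
  forall (s : seq 'I_n) x, U x -> differentiable (foldr pd F s) x.

Definition dcoord F x : 'rV[R]_n := \row_i pd i F x.

(* Gamma^k_ij *)
Definition christoffel g (k i j : 'I_n) x : R :=
  2^-1 * \sum_l invmx (g x) k l *
    (pd i (fun y => g y j l) x + pd j (fun y => g y i l) x
     - pd l (fun y => g y i j) x).

(* d_k of R(d_i, d_j) d_l, with
   R(X, Y) Z = D_X D_Y Z - D_Y D_X Z - D_[X, Y] Z. *)
Definition riemann g (k l i j : 'I_n) x : R :=
  pd i (christoffel g k j l) x - pd j (christoffel g k i l) x
  + \sum_m (christoffel g k i m x * christoffel g m j l x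
            - christoffel g k j m x * christoffel g m i l x).

(* Ric(Y, Z) = trace (X |-> R(X, Y) Z), positive on round spheres *)
Definition ricci g x : 'M[R]_n := \matrix_(j, l) \sum_k riemann g k l k j x.

Definition scalar_curvature g x : R :=
  \sum_i \sum_j invmx (g x) i j * ricci g x i j.

Definition hessian g F x : 'M[R]_n :=
  \matrix_(i, j) (pd i (pd j F) x - \sum_k christoffel g k i j x * pd k F x).

End Coordinates.

(* chart a is meant only on dom a, and its inverse param a only on the open
   set chart a @` dom a; outside they are arbitrary. *)
Record smooth_manifold (R : realType) (n : nat) (M : topologicalType) := {
  idx : Type;
  dom : idx -> set M;
  chart : idx -> M -> 'rV[R]_n;
  param : idx -> 'rV[R]_n -> M;
  mfd_hausdorff : hausdorff_space M;
  mfd_second_countable : @second_countable M;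
  mfd_connected : connected [set: M];
  dom_cover : forall p, exists a, dom a p;
  dom_open : forall a, open (dom a);
  range_open : forall a, open (chart a @` dom a);
  chartK : forall a p, dom a p -> param a (chart a p) = p;
  chart_continuous : forall a, {within dom a, continuous (chart a)};
  param_continuous : forall a,
    {within chart a @` dom a, continuous (param a)};
  transition_smooth : forall a b (k : 'I_n),
    smooth_on (chart a @` (dom a `&` dom b))
              (fun x => chart b (param a x) 0 k) }.

Section Manifold.
Variables (R : realType) (n : nat) (M : topologicalType).
Variable X : smooth_manifold R n M.

Definition crange (a : idx X) : set 'rV[R]_n := chart a @` dom a.

Definition in_chart (a : idx X) (f : M -> R) : 'rV[R]_n -> R :=
  f \o param a.

Definition smooth (f : M -> R) : Prop :=
  forall a, smooth_on (crange a) (in_chart a f).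

Definition nonconstant (f : M -> R) : Prop := ~ exists c, forall p, f p = c.

(* (J a b x) i k = d y^k / d x^i, for the change of coordinates y = y(x)
   from chart a to chart b *)
Definition transition_jac (a b : idx X) (x : 'rV[R]_n) : 'M[R]_n :=
  \matrix_(i, k) pd i (fun y => chart b (param a y) 0 k) x.

Record riemannian_metric := {
  metric :> idx X -> 'rV[R]_n -> 'M[R]_n;
  metric_smooth : forall a i j,
    smooth_on (crange a) (fun x => metric a x i j);
  metric_sym : forall a x, crange a x -> (metric a x)^T = metric a x;
  metric_pos : forall a x (v : 'rV[R]_n), crange a x -> v != 0 ->
    0 < (v *m metric a x *m v^T) 0 0;
  metric_compat : forall a b p, dom a p -> dom b p ->
    let J := transition_jac a b (chart a p) in
    metric a (chart a p) = J *m metric b (chart b p) *m J^T }.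

Variable g : riemannian_metric.

Definition gradient_einstein_type (alpha beta mu rho : R) (f lambda : M -> R)
    : Prop :=
  [/\ smooth f, smooth lambda, (alpha, beta, mu) <> (0, 0, 0) &
  forall a p, dom a p ->
    let x := chart a p in
    let F := in_chart a f in
    alpha *: ricci (g a) x + beta *: hessian (g a) F x
      + mu *: ((dcoord F x)^T *m dcoord F x)
    = (rho * scalar_curvature (g a) x + lambda p) *: g a x].

Definition einstein : Prop := forall a x, crange a x ->
  ricci (g a) x = (scalar_curvature (g a) x / n%:R) *: g a x.

Definition constant_scalar_curvature (S : R) : Prop :=
  forall a x, crange a x -> scalar_curvature (g a) x = S.

Definition special_concircular (u : M -> R) (k b : R) : Prop :=
  [/\ smooth u, nonconstant u &
  forall a p, dom a p ->
    hessian (g a) (in_chart a u) (chart a p)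
    = (- k * u p + b) *: g a (chart a p)].

End Manifold.

(* Main.v *)
(** Writing [r = mu / beta], the structure equation and [Ric = (S / n) g] give
    [Hess u = psi g] with [psi = r u (rho S + lambda - alpha S / n) / beta].
    Commuting third covariant derivatives of [u] and contracting yields
    [(n - 1) d psi = - Ric (grad u) = - (S / n) du]. Hence [psi + k u] with
    [k = S / (n (n - 1))] is locally constant, so constant on the connected [M],
    as soon as [S] is constant. The latter is Schur's lemma, from the twice
    contracted second Bianchi identity. Since [scalar_curvature] is given chart
    by chart, one also needs that its values agree on overlaps: this follows
    from the transformation law of the Ricci tensor, obtained by viewing the
    Levi-Civita connection as a matrix-valued gauge field. *)
Require Import Defs.
From HB Require Import structures.
From mathcomp Require Import all_boot all_order all_algebra.
From mathcomp Require Import all_classical all_reals all_analysis.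
From mathcomp Require Import ring.
Import Order.TTheory GRing.Theory Num.Theory.
Import numFieldNormedType.Exports.
Local Open Scope classical_set_scope.
Local Open Scope ring_scope.

Set Implicit Arguments.
Unset Strict Implicit.
Unset Printing Implicit Defensive.

(** * Partial derivatives *)

(** Sums over Christoffel symbols are hidden in matrix products. For each coordinate direction the
    connection is one matrix [A_i], so that curvature is [d_i A_j - d_j A_i + [A_i, A_j]], and the
    Bianchi identity, the behaviour under a change of chart and the integrability of the Hessian
    equation become identities between noncommuting matrices. Components return only when traces are
    taken. Raising an index makes the curvature antisymmetric in each of its two pairs; these
    antisymmetries and the Ricci trace are what the contractions use. The analytic engine behind all
    these identities is the symmetry of second partial derivatives: of the metric, of the connection
    matrices, of [du], and of the coordinate change. It is derived from the mean value theorem.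
    Schur's lemma arrives as [n dphi = 2 dphi] for the factor [phi] in [Ric = phi g], which is where
    [n >= 3] enters. *)

Lemma near_eq_differentiable (R : numFieldType) (V W : normedModType R)
    (f g : V -> W) (x : V) :
  {near x, f =1 g} -> differentiable f x -> differentiable g x.
Proof.
move=> fg /diff_locallyP[dc de].
have fgx : f x = g x by exact: (nbhs_singleton fg).
have fg0 : \forall h \near nbhs (0 : V), f (h + x) = g (h + x).
  by move/nbhs0P: fg; apply: filterS => h; rewrite /= addrC.
(* The differential of [f] also serves [g]: the bound on the remainder at [0] involves only values
   near [x]. *)
have e : g \o shift x = cst (g x) + 'd f x +o_ 0 id.
  apply/eqaddoP => e e0; move/eqaddoP: de => /(_ e e0).
  by apply: filterS2 fg0 => h /= fgh; rewrite !fctE /= fgh fgx.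
by apply/diff_locallyP; rewrite (diff_unique dc e).
Qed.

Section PartialDerivatives.
Variables (R : realType) (n : nat).
Implicit Types (F G : 'rV[R]_n -> R) (x v w : 'rV[R]_n) (U : set 'rV[R]_n).

Lemma eq_on_differentiable U F G x : open U -> U x -> {in U, F =1 G} ->
  differentiable F x -> differentiable G x.
Proof.
move=> oU Ux FG; apply: near_eq_differentiable.
apply: filterS (open_nbhs_nbhs (conj oU Ux)) => y Uy.
by apply: FG; rewrite inE.
Qed.

Lemma eq_on_pd U F G i x : open U -> U x -> {in U, F =1 G} ->
  pd i F x = pd i G x.
Proof.
move=> oU Ux FG; apply: near_eq_derive; apply: filterS (open_nbhs_nbhs (conj oU Ux)).
by move=> y Uy; apply: FG; rewrite inE.
Qed.

Lemma pd_cst (c : R) i x : pd i (fun=> c) x = 0.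
Proof. exact: derive_cst. Qed.

Lemma pdD F G i x : differentiable F x -> differentiable G x ->
  pd i (fun y => F y + G y) x = pd i F x + pd i G x.
Proof. by move=> dF dG; apply: deriveD; apply: diff_derivable. Qed.

Lemma pdN F i x : differentiable F x -> pd i (fun y => - F y) x = - pd i F x.
Proof. by move=> dF; apply: deriveN; apply: diff_derivable. Qed.

Lemma pdB F G i x : differentiable F x -> differentiable G x ->
  pd i (fun y => F y - G y) x = pd i F x - pd i G x.
Proof. by move=> dF dG; apply: deriveB; apply: diff_derivable. Qed.

Lemma pdM F G i x : differentiable F x -> differentiable G x ->
  pd i (fun y => F y * G y) x = pd i F x * G x + F x * pd i G x.
Proof.
move=> dF dG; rewrite /pd.
have -> : (fun y => F y * G y) = F * G by [].
rewrite deriveM; [|exact: diff_derivable..].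
by rewrite addrC mulrC.
Qed.

Lemma pdV F i x : differentiable F x -> F x != 0 ->
  pd i (fun y => (F y)^-1) x = - pd i F x * ((F x)^-1 * (F x)^-1).
Proof.
move=> dF F0; rewrite /pd deriveV//; last exact: diff_derivable.
by rewrite /GRing.scale/= -expr2 exprVn mulrC mulrN mulNr mulrC.
Qed.

Lemma pd_sum (I : Type) (s : seq I) (F : I -> 'rV[R]_n -> R) i x :
  (forall k, differentiable (F k) x) ->
  pd i (fun y => \sum_(k <- s) F k y) x = \sum_(k <- s) pd i (F k) x.
Proof.
move=> dF; suff [] : differentiable (fun y => \sum_(k <- s) F k y) x /\
  pd i (fun y => \sum_(k <- s) F k y) x = \sum_(k <- s) pd i (F k) x by [].
elim: s => [|k s [ds IH]].
  under eq_fun do rewrite big_nil.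
  by rewrite big_nil pd_cst; split=> //; exact: differentiable_cst.
under eq_fun do rewrite big_cons.
by rewrite big_cons pdD// IH; split=> //; exact: differentiableD.
Qed.

Lemma differentiable_expR F x : differentiable F x ->
  differentiable (fun y => expR (F y)) x.
Proof.
move=> dF; apply: (@differentiable_comp _ _ _ _ F (@expR R)) => //.
exact/derivable1_diffP/derivable_expR.
Qed.

Lemma pd_expR F i x : differentiable F x ->
  pd i (fun y => expR (F y)) x = expR (F x) * pd i F x.
Proof.
move=> dF; rewrite /pd !deriveE//; last exact: differentiable_expR.
have dE : differentiable (@expR R) (F x).
  exact/derivable1_diffP/derivable_expR.
rewrite (@diff_comp _ _ _ _ F (@expR R))//= deriv1E; last exact: derivable_expR.
rewrite derive1E (@derive_val _ _ _ _ _ _ _ (is_derive_expR _)).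
by rewrite /GRing.scale/= mulrC.
Qed.

Lemma diff_sum_pd F x v : differentiable F x ->
  'd F x v = \sum_i v 0 i * pd i F x.
Proof.
move=> dF; rewrite {1}[v]row_sum_delta linear_sum; apply: eq_bigr => i _.
by rewrite linearZ /pd deriveE.
Qed.

Lemma mean_value_line F x v :
  (forall t : R, 0 <= t <= 1 -> differentiable F (x + t *: v)) ->
  exists2 c : R, 0 <= c <= 1 & F (x + v) - F x = 'd F (x + c *: v) v.
Proof.
move=> dF; pose l (t : R) := x + t *: v.
have dl (t : R) : is_diff t l (fun s => s *: v).
  have : is_diff t (cst x + ( *:%R^~ v)) (0 + ( *:%R^~ v)) by exact: is_diffD.
  by rewrite add0r.
have dg (t : R) : 0 <= t <= 1 -> is_derive t 1 (F \o l) ('d F (l t) v).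
  move=> t01; apply: DeriveDef.
    apply/derivable1_diffP; apply: differentiable_comp; first exact: ex_diff.
    exact: dF.
  rewrite deriveE; last by apply: differentiable_comp; [exact: ex_diff|exact: dF].
  by rewrite diff_comp//=; [rewrite diff_val scale1r|exact: dF].
have [||c] := @MVT_segment R (F \o l) (fun t => 'd F (l t) v) 0 1 ler01.
- by move=> t; rewrite in_itv/= => /andP[t0 t1]; apply: dg; rewrite !ltW.
- apply: derivable_within_continuous => t; rewrite in_itv/= => t01.
  by have [] := dg _ t01.
rewrite in_itv/= => c01 e; exists c => //.
by move: e; rewrite /l /= scale1r scale0r addr0 subr0 mulr1.
Qed.

(** A ball around [x] inside [U] contains the segment from [x] to each of its points, so the mean
    value theorem applies along it. *)
Lemma pd0_locally_constant U F x : open U -> U x ->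
  (forall y, U y -> differentiable F y) ->
  (forall y i, U y -> pd i F y = 0) ->
  \forall y \near x, F y = F x.
Proof.
move=> oU Ux dF F0.
have /nbhs_ballP[r /= r0 rU] := open_nbhs_nbhs (conj oU Ux).
apply/nbhs_ballP; exists r => // y xy; apply/eqP; rewrite -subr_eq0.
have inU t : 0 <= t <= 1 -> U (x + t *: (y - x)).
  move=> /andP[t0 t1]; apply: rU; move: xy; rewrite -!ball_normE/= => xy.
  rewrite opprD addrA subrr add0r normrN normrZ ger0_norm// distrC.
  by apply: le_lt_trans xy; rewrite ler_piMl.
have [|c c01] := @mean_value_line F x (y - x).
  by move=> t t01; apply: dF; exact: inU.
rewrite [x + (y - x)]addrC subrK => ->; rewrite diff_sum_pd; last exact/dF/inU.
by apply/eqP; rewrite big1// => i _; rewrite F0 ?mulr0//; exact: inU.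
Qed.

Lemma pd_shift F w i x : pd i (fun y => F (y + w)) x = pd i F (x + w).
Proof. by rewrite /pd /derive; do 2 f_equal; apply/funext => h /=; rewrite addrA. Qed.

Lemma differentiable_shift F w x : differentiable F (x + w) ->
  differentiable (fun y => F (y + w)) x.
Proof.
by move=> dF; apply: (@differentiable_comp _ _ _ _ (fun y => y + w) F).
Qed.

(** The mean value theorem is applied along [e i] to the increment [K] of [F] in direction [e j],
    then along [e j] to [pd i F]. *)
Lemma second_difference U F x i j (h : R) :
  (forall y, U y -> differentiable F y) ->
  (forall y, U y -> differentiable (pd i F) y) ->
  let e k : 'rV[R]_n := delta_mx 0 k in
  (forall s t : R, 0 <= s <= h -> 0 <= t <= h -> U (x + s *: e i + t *: e j)) ->
  0 <= h ->
  exists s t : R, [/\ 0 <= s <= h, 0 <= t <= h &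
    F (x + h *: e i + h *: e j) - F (x + h *: e i) - (F (x + h *: e j) - F x)
    = h * (h * pd j (pd i F) (x + s *: e i + t *: e j))].
Proof.
move=> dF ddF e inU h0.
have scale01 (c : R) : 0 <= c <= 1 -> 0 <= c * h <= h.
  by move=> /andP[c0 c1]; rewrite mulr_ge0//= ler_piMl.
have h0h : 0 <= h <= h by rewrite h0 lexx.
have z0h : 0 <= (0 : R) <= h by rewrite lexx.
have inU0 s : 0 <= s <= h -> U (x + s *: e i).
  by move=> hs; have := inU s 0 hs z0h; rewrite scale0r addr0.
have dZ c (G : 'rV[R]_n -> R) y k : differentiable G y ->
    'd G y (c *: e k) = c * pd k G y.
  by move=> dG; rewrite linearZ /pd deriveE.
pose K y := F (y + h *: e j) - F y.
have dK s : 0 <= s <= h -> differentiable K (x + s *: e i).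
  move=> hs; apply: differentiableB; last exact/dF/inU0.
  exact/differentiable_shift/dF/inU.
have [|c c01] := @mean_value_line K x (h *: e i).
  by move=> t t01; rewrite scalerA; exact/dK/scale01.
rewrite scalerA; have := scale01 _ c01; set s := c * h => hs.
rewrite dZ ?pdB ?pd_shift; last first.
- exact: dK.
- exact/dF/inU0.
- exact/differentiable_shift/dF/inU.
have [|d d01] := @mean_value_line (pd i F) (x + s *: e i) (h *: e j).
  by move=> t t01; rewrite scalerA; apply/ddF/inU => //; exact/scale01.
rewrite scalerA; have := scale01 _ d01; set t := d * h => ht.
rewrite dZ; last exact/ddF/inU.
by move=> E2 E1; exists s, t; split; rewrite // -E2 -E1.
Qed.

(* Two applications of the mean value theorem, in either order, express the
   same second difference by either of the mixed partial derivatives. *)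
Lemma pdC U F x i j : open U -> U x ->
  (forall y, U y -> differentiable F y) ->
  (forall k y, U y -> differentiable (pd k F) y) ->
  {for x, continuous (pd i (pd j F))} ->
  {for x, continuous (pd j (pd i F))} ->
  pd i (pd j F) x = pd j (pd i F) x.
Proof.
move=> oU Ux dF ddF cij cji; apply/eqP; rewrite -subr_eq0 -normr_le0.
apply/ler_addgt0Pr => eps eps0; rewrite add0r.
have eps2 : 0 < eps / 2 by rewrite divr_gt0.
pose P y := U y /\ (`|pd i (pd j F) x - pd i (pd j F) y| < eps / 2 /\
  `|pd j (pd i F) x - pd j (pd i F) y| < eps / 2).
have nP : nbhs x P.
  apply: filterI; first exact: open_nbhs_nbhs.
  by apply: filterI; [exact: (proj1 (@cvgrPdist_lt _ _ _ _ (nbhs_filter x) _ _) cij)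
    |exact: (proj1 (@cvgrPdist_lt _ _ _ _ (nbhs_filter x) _ _) cji)].
have [r r0 rU] := proj1 (nbhs_ballP _ _) nP.
have rpos : 0 < r := r0.
pose e k : 'rV[R]_n := delta_mx 0 k.
pose N := `|e i| + `|e j| + 1.
have N0 : 0 < N by rewrite /N ltr_wpDl// addr_ge0.
(* The square of side [h] stays within distance [h * N = r / 2] of [x]; the summand [1] in [N] keeps
   the denominator positive. *)
pose h := r / (2 * N).
have h0 : 0 < h by rewrite /h divr_gt0// mulr_gt0.
have inball s t : 0 <= s <= h -> 0 <= t <= h ->
    ball x r (x + s *: e i + t *: e j).
  move=> /andP[s0 sh] /andP[t0 th]; rewrite -ball_normE/= -addrA opprD addrA subrr.
  rewrite add0r normrN (le_lt_trans (ler_normD _ _))// !normrZ !ger0_norm//.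
  apply: (@le_lt_trans _ _ (h * N)).
    rewrite /N 2!mulrDr mulr1 -[leLHS]addr0 lerD ?(ltW h0)//.
    by rewrite lerD ?ler_wpM2r.
  by rewrite /h invfM mulrA mulfVK ?gt_eqF// ltr_pdivrMr// ltr_pMr// ltr1n.
have inball' s t : 0 <= s <= h -> 0 <= t <= h ->
    ball x r (x + s *: e j + t *: e i).
  by move=> hs ht; rewrite addrAC; exact: inball.
have [||s [t [hs ht E1]]] := @second_difference U F x i j h dF (ddF i).
- by move=> s t hs ht; have [] := rU _ (inball _ _ hs ht).
- exact: ltW.
have [||s' [t' [hs' ht' E2]]] := @second_difference U F x j i h dF (ddF j).
- by move=> s' t' hs' ht'; have [] := rU _ (inball' _ _ hs' ht').
- exact: ltW.
have E : pd j (pd i F) (x + s *: e i + t *: e j) =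
         pd i (pd j F) (x + s' *: e j + t' *: e i).
  apply: (mulfI (lt0r_neq0 h0)); apply: (mulfI (lt0r_neq0 h0)).
  (* Regrouping shows that the second difference is symmetric in [i] and [j]. *)
  have aux (a b c d : R) : a - b - (c - d) = a - c - (b - d) by ring.
  rewrite (addrAC x) aux in E1.
  exact: etrans (esym E1) E2.
have [_ [_ B1]] := rU _ (inball _ _ hs ht).
have [_ [B2 _]] := rU _ (inball' _ _ hs' ht').
rewrite E distrC in B1.
have B := ltW (ltrD B2 B1); rewrite -splitr in B.
exact: le_trans (ler_distD _ _ _) B.
Qed.

End PartialDerivatives.

Lemma differentiable_row (R : realType) (n m : nat) (y : 'rV[R]_n -> 'rV[R]_m) x :
  (forall k, differentiable (fun z => y z 0 k) x) -> differentiable y x.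
Proof.
move=> dy.
have -> : y = \sum_k (fun z => y z 0 k *: (delta_mx 0 k : 'rV[R]_m)).
  by apply/funext => z; rewrite fct_sumE {1}[y z]row_sum_delta.
by apply: differentiable_sum => k; exact: differentiableZl.
Qed.

(** * Chain rule for partial derivatives *)

Section ChainRule.
Variables (R : realType) (n m : nat) (y : 'rV[R]_n -> 'rV[R]_m).
Variables (F : 'rV[R]_m -> R) (x : 'rV[R]_n).
Hypothesis dy : forall k, differentiable (fun z => y z 0 k) x.
Hypothesis dF : differentiable F (y x).

Lemma differentiable_chain : differentiable (fun z => F (y z)) x.
Proof. by apply: (@differentiable_comp _ _ _ _ y F) => //; exact: differentiable_row. Qed.

Lemma pd_chain i :
  pd i (fun z => F (y z)) x = \sum_k pd i (fun z => y z 0 k) x * pd k F (y x).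
Proof.
have dy' := differentiable_row dy.
rewrite {1}/pd deriveE; last exact: differentiable_chain.
rewrite (@diff_comp _ _ _ _ y F)//= diff_sum_pd//; apply: eq_bigr => k _.
rewrite /pd -deriveE//; congr (_ * _).
rewrite derive_mx; last exact: diff_derivable.
by rewrite mxE.
Qed.

End ChainRule.

(** * Smooth functions *)

Section Smoothness.
Variables (R : realType) (n : nat) (U : set 'rV[R]_n).
Hypothesis oU : open U.
Implicit Types (F G : 'rV[R]_n -> R) (x : 'rV[R]_n).

(** Smoothness up to a finite order, peeling off the innermost derivative. Derivatives of products,
    inverses and exponentials involve the functions themselves again, so closure needs an induction
    on the order. Order [0] demands nothing, not even continuity. *)
Fixpoint Ck (k : nat) F : Prop :=
  if k is k'.+1 then
    (forall x, U x -> differentiable F x) /\ forall i, Ck k' (pd i F)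
  else True.

Lemma smooth_on_pd i F : smooth_on U F -> smooth_on U (pd i F).
Proof. by move=> sF s x Ux; rewrite -foldr_rcons; exact: sF. Qed.

Lemma smooth_on_differentiable F x : smooth_on U F -> U x -> differentiable F x.
Proof. by move=> sF Ux; exact: (sF [::]). Qed.

Lemma smooth_onP F : smooth_on U F <-> forall k, Ck k F.
Proof.
split=> [sF k|].
  elim: k F sF => [//|k IH] F sF /=; split=> [x Ux|i].
    exact: smooth_on_differentiable.
  exact/IH/smooth_on_pd.
move=> sF s; have := sF (size s).+1; move: s F {sF}.
apply: last_ind => [|s i IH] F; first by case.
by rewrite size_rcons => -[_ /(_ i)] ? x Ux; rewrite foldr_rcons; exact: IH.
Qed.

Lemma eq_Ck k F G : {in U, F =1 G} -> Ck k F -> Ck k G.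
Proof.
elim: k F G => // k IH F G FG [dF kF]; split=> [x Ux|i].
  by apply: (eq_on_differentiable oU Ux FG); exact: dF.
apply: IH (kF i) => x; rewrite inE => Ux; exact: eq_on_pd FG.
Qed.

Lemma CkW k F : Ck k.+1 F -> Ck k F.
Proof. by elim: k F => // k IH F [dF kF]; split=> // i; exact: IH. Qed.

Lemma Ck_cst k (c : R) : Ck k (fun=> c).
Proof.
elim: k c => // k IH c; split=> [x _|i]; first exact: differentiable_cst.
by apply: eq_Ck (IH 0) => x _; rewrite pd_cst.
Qed.

Lemma CkD k F G : Ck k F -> Ck k G -> Ck k (fun x => F x + G x).
Proof.
elim: k F G => // k IH F G [dF kF] [dG kG]; split=> [x Ux|i].
  by apply: differentiableD; auto.
apply: eq_Ck (IH _ _ (kF i) (kG i)) => x; rewrite inE => Ux.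
by rewrite pdD; auto.
Qed.

Lemma CkM k F G : Ck k F -> Ck k G -> Ck k (fun x => F x * G x).
Proof.
elim: k F G => // k IH F G kF kG; have [dF dkF] := kF; have [dG dkG] := kG.
split=> [x Ux|i]; first by apply: differentiableM; auto.
apply: eq_Ck (CkD (IH _ _ (dkF i) (CkW kG)) (IH _ _ (CkW kF) (dkG i))).
by move=> x; rewrite inE => Ux; rewrite pdM; auto.
Qed.

Lemma CkN k F : Ck k F -> Ck k (fun x => - F x).
Proof.
move=> kF; apply: eq_Ck (CkM (Ck_cst k (-1)) kF) => x _.
by rewrite mulN1r.
Qed.

Lemma CkV k F : {in U, forall x, F x != 0} -> Ck k F -> Ck k (fun x => (F x)^-1).
Proof.
move=> F0; elim: k => // k IH kF; have [dF dkF] := kF.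
split=> [x Ux|i]; first by apply: differentiableV; [exact: dF|exact/F0/mem_set].
have kV := IH (CkW kF).
apply: eq_Ck (CkM (CkN (dkF i)) (CkM kV kV)).
by move=> x; rewrite inE => Ux; rewrite pdV//; [exact: dF|exact/F0/mem_set].
Qed.

Lemma Ck_expR k F : Ck k F -> Ck k (fun x => expR (F x)).
Proof.
elim: k => // k IH kF; have [dF dkF] := kF.
split=> [x Ux|i]; first exact/differentiable_expR/dF.
apply: eq_Ck (CkM (IH (CkW kF)) (dkF i)).
by move=> x; rewrite inE => Ux; rewrite pd_expR//; exact: dF.
Qed.

Lemma eq_smooth_on F G : {in U, F =1 G} -> smooth_on U F -> smooth_on U G.
Proof. by move=> FG /smooth_onP sF; apply/smooth_onP => k; exact: eq_Ck (sF k). Qed.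

Lemma smooth_on_cst (c : R) : smooth_on U (fun=> c).
Proof. by apply/smooth_onP => k; exact: Ck_cst. Qed.

Lemma smooth_onD F G : smooth_on U F -> smooth_on U G ->
  smooth_on U (fun x => F x + G x).
Proof. by move=> /smooth_onP sF /smooth_onP sG; apply/smooth_onP => k; exact: CkD. Qed.

Lemma smooth_onM F G : smooth_on U F -> smooth_on U G ->
  smooth_on U (fun x => F x * G x).
Proof. by move=> /smooth_onP sF /smooth_onP sG; apply/smooth_onP => k; exact: CkM. Qed.

Lemma smooth_onN F : smooth_on U F -> smooth_on U (fun x => - F x).
Proof. by move=> /smooth_onP sF; apply/smooth_onP => k; exact: CkN. Qed.

Lemma smooth_onB F G : smooth_on U F -> smooth_on U G ->
  smooth_on U (fun x => F x - G x).
Proof. by move=> sF sG; apply: smooth_onD => //; exact: smooth_onN. Qed.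

Lemma smooth_onV F : {in U, forall x, F x != 0} -> smooth_on U F ->
  smooth_on U (fun x => (F x)^-1).
Proof. by move=> F0 /smooth_onP sF; apply/smooth_onP => k; exact: CkV. Qed.

Lemma smooth_on_expR F : smooth_on U F -> smooth_on U (fun x => expR (F x)).
Proof. by move=> /smooth_onP sF; apply/smooth_onP => k; exact: Ck_expR. Qed.

Lemma smooth_on_sum (I : Type) (s : seq I) (F : I -> 'rV[R]_n -> R) :
  (forall k, smooth_on U (F k)) -> smooth_on U (fun x => \sum_(k <- s) F k x).
Proof.
move=> sF; elim: s => [|k s IH].
  by under eq_fun do rewrite big_nil; exact: smooth_on_cst.
by under eq_fun do rewrite big_cons; exact: smooth_onD.
Qed.

Lemma smooth_on_prod (I : Type) (s : seq I) (F : I -> 'rV[R]_n -> R) :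
  (forall k, smooth_on U (F k)) -> smooth_on U (fun x => \prod_(k <- s) F k x).
Proof.
move=> sF; elim: s => [|k s IH].
  by under eq_fun do rewrite big_nil; exact: smooth_on_cst.
by under eq_fun do rewrite big_cons; exact: smooth_onM.
Qed.

Lemma smooth_on_det p (A : 'rV[R]_n -> 'M[R]_p) :
  (forall i j, smooth_on U (fun x => A x i j)) -> smooth_on U (fun x => \det (A x)).
Proof.
move=> sA; rewrite /determinant; apply: smooth_on_sum => s.
by apply: smooth_onM; [exact: smooth_on_cst|exact: smooth_on_prod].
Qed.

Lemma smooth_on_invmx p (A : 'rV[R]_n -> 'M[R]_p) :
  (forall x, U x -> A x \in unitmx) ->
  (forall i j, smooth_on U (fun x => A x i j)) ->
  forall i j, smooth_on U (fun x => invmx (A x) i j).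
Proof.
move=> uA sA i j.
(* The cofactor formula makes the entries of the inverse rational in those of [A]. *)
apply: (@eq_smooth_on (fun x => (\det (A x))^-1 *
    ((-1) ^+ (j + i) * \det (row' j (col' i (A x)))))).
  by move=> x; rewrite inE => Ux; rewrite /invmx uA// !mxE /cofactor.
apply: smooth_onM.
  apply: smooth_onV; last exact: smooth_on_det.
  by move=> x; rewrite inE => /uA; rewrite unitmxE unitfE.
apply: smooth_onM; first exact: smooth_on_cst.
by apply: smooth_on_det => k l; under eq_fun do rewrite !mxE; exact: sA.
Qed.

Lemma smooth_pdC F i j x : smooth_on U F -> U x ->
  pd i (pd j F) x = pd j (pd i F) x.
Proof.
move=> sF Ux; have d G y : smooth_on U G -> U y -> differentiable G y.
  by move=> sG Uy; exact: smooth_on_differentiable.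
apply: (@pdC _ _ U) => //.
- by move=> y; exact: d.
- by move=> k y; apply: d; exact: smooth_on_pd.
- by apply/differentiable_continuous/d => //; do 2 apply: smooth_on_pd.
- by apply/differentiable_continuous/d => //; do 2 apply: smooth_on_pd.
Qed.

End Smoothness.

Lemma smooth_on_sub (R : realType) (n : nat) (U V : set 'rV[R]_n) F :
  V `<=` U -> smooth_on U F -> smooth_on V F.
Proof. by move=> VU sF s x /VU; exact: sF. Qed.

(** * Matrix-valued functions and the Levi-Civita connection *)

(* Locked, as conversion problems between two derivatives would otherwise be
   decided by unfolding limits. *)
HB.lock Definition mxpd (R : realType) (n p q : nat) (i : 'I_n)
  (A : 'rV[R]_n -> 'M[R]_(p, q)) (x : 'rV[R]_n) : 'M[R]_(p, q) :=
  \matrix_(k, l) pd i (fun y => A y k l) x.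

Lemma mxpdE (R : realType) (n p q : nat) i (A : 'rV[R]_n -> 'M[R]_(p, q)) x k l :
  mxpd i A x k l = pd i (fun y => A y k l) x.
Proof. by rewrite mxpd.unlock mxE. Qed.

Section MatrixDerivatives.
Variables (R : realType) (n : nat) (U : set 'rV[R]_n).
Hypothesis oU : open U.

Definition mxsmooth (p q : nat) (A : 'rV[R]_n -> 'M[R]_(p, q)) : Prop :=
  forall k l, smooth_on U (fun y => A y k l).

Lemma mxsmooth_cst p q (C : 'M[R]_(p, q)) : mxsmooth (fun=> C).
Proof. by move=> k l; exact: smooth_on_cst. Qed.

Lemma mxsmoothD p q (A B : 'rV[R]_n -> 'M[R]_(p, q)) :
  mxsmooth A -> mxsmooth B -> mxsmooth (fun x => A x + B x).
Proof. by move=> sA sB k l; under eq_fun do rewrite mxE; exact: smooth_onD. Qed.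

Lemma mxsmoothN p q (A : 'rV[R]_n -> 'M[R]_(p, q)) :
  mxsmooth A -> mxsmooth (fun x => - A x).
Proof. by move=> sA k l; under eq_fun do rewrite mxE; exact: smooth_onN. Qed.

Lemma mxsmoothM p q r (A : 'rV[R]_n -> 'M[R]_(p, q)) (B : 'rV[R]_n -> 'M[R]_(q, r)) :
  mxsmooth A -> mxsmooth B -> mxsmooth (fun x => A x *m B x).
Proof.
move=> sA sB k l; under eq_fun do rewrite mxE.
by apply: smooth_on_sum => // m; exact: smooth_onM.
Qed.

Lemma mxsmoothZ p q (f : 'rV[R]_n -> R) (A : 'rV[R]_n -> 'M[R]_(p, q)) :
  smooth_on U f -> mxsmooth A -> mxsmooth (fun x => f x *: A x).
Proof. by move=> sf sA k l; under eq_fun do rewrite mxE; exact: smooth_onM. Qed.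

Lemma mxsmooth_tr p q (A : 'rV[R]_n -> 'M[R]_(p, q)) :
  mxsmooth A -> mxsmooth (fun x => (A x)^T).
Proof. by move=> sA k l; under eq_fun do rewrite mxE; exact: sA. Qed.

Lemma mxsmooth_inv p (A : 'rV[R]_n -> 'M[R]_p) :
  (forall x, U x -> A x \in unitmx) -> mxsmooth A -> mxsmooth (fun x => invmx (A x)).
Proof. by move=> uA sA k l; exact: smooth_on_invmx. Qed.

Lemma mxsmooth_pd p q i (A : 'rV[R]_n -> 'M[R]_(p, q)) :
  mxsmooth A -> mxsmooth (mxpd i A).
Proof. by move=> sA k l; under eq_fun do rewrite mxpdE; exact: smooth_on_pd. Qed.

Variable x : 'rV[R]_n.
Hypothesis Ux : U x.

Lemma eq_mxpd p q i (A B : 'rV[R]_n -> 'M[R]_(p, q)) :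
  (forall y, U y -> A y = B y) -> mxpd i A x = mxpd i B x.
Proof.
move=> AB; apply/matrixP => k l; rewrite !(mxpdE, mxE); apply: (eq_on_pd _ oU Ux) => y.
by rewrite inE => /AB ->.
Qed.

Lemma mxpd_cst p q i (C : 'M[R]_(p, q)) : mxpd i (fun=> C) x = 0.
Proof. by apply/matrixP => k l; rewrite !(mxpdE, mxE) pd_cst. Qed.

Lemma mxpdD p q i (A B : 'rV[R]_n -> 'M[R]_(p, q)) : mxsmooth A -> mxsmooth B ->
  mxpd i (fun y => A y + B y) x = mxpd i A x + mxpd i B x.
Proof.
move=> sA sB; apply/matrixP => k l; rewrite !(mxpdE, mxE).
under [X in pd i X]eq_fun do rewrite mxE.
by rewrite pdD//; exact: smooth_on_differentiable Ux.
Qed.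

Lemma mxpdN p q i (A : 'rV[R]_n -> 'M[R]_(p, q)) : mxsmooth A ->
  mxpd i (fun y => - A y) x = - mxpd i A x.
Proof.
move=> sA; apply/matrixP => k l; rewrite !(mxpdE, mxE).
under [X in pd i X]eq_fun do rewrite mxE.
by rewrite pdN//; exact: smooth_on_differentiable Ux.
Qed.

Lemma mxpdM p q r i (A : 'rV[R]_n -> 'M[R]_(p, q)) (B : 'rV[R]_n -> 'M[R]_(q, r)) :
  mxsmooth A -> mxsmooth B ->
  mxpd i (fun y => A y *m B y) x = mxpd i A x *m B x + A x *m mxpd i B x.
Proof.
move=> sA sB; apply/matrixP => k l; rewrite !(mxpdE, mxE).
under [X in pd i X]eq_fun do rewrite mxE.
have dA m := smooth_on_differentiable (sA k m) Ux.
have dB m := smooth_on_differentiable (sB m l) Ux.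
rewrite pd_sum; last by move=> m; exact: differentiableM.
by rewrite -big_split; apply: eq_bigr => m _; rewrite !(mxpdE, mxE) pdM.
Qed.

Lemma mxpdZ p q i (f : 'rV[R]_n -> R) (A : 'rV[R]_n -> 'M[R]_(p, q)) :
  smooth_on U f -> mxsmooth A ->
  mxpd i (fun y => f y *: A y) x = pd i f x *: A x + f x *: mxpd i A x.
Proof.
move=> sf sA; apply/matrixP => k l; rewrite !(mxpdE, mxE).
under [X in pd i X]eq_fun do rewrite mxE.
by rewrite pdM//; exact: smooth_on_differentiable Ux.
Qed.

Lemma mxpd_tr p q i (A : 'rV[R]_n -> 'M[R]_(p, q)) :
  mxpd i (fun y => (A y)^T) x = (mxpd i A x)^T.
Proof.
by apply/matrixP => k l; rewrite !(mxpdE, mxE); under [X in pd i X]eq_fun do rewrite mxE.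
Qed.

Lemma mxpdC p q i j (A : 'rV[R]_n -> 'M[R]_(p, q)) : mxsmooth A ->
  mxpd i (mxpd j A) x = mxpd j (mxpd i A) x.
Proof.
move=> sA; apply/matrixP => k l; rewrite 2!mxpdE.
have E a : (fun y => mxpd a A y k l) = pd a (fun y => A y k l).
  by apply/funext => y; rewrite mxpdE.
by rewrite (E j) (E i); exact: (smooth_pdC oU i j (sA k l) Ux).
Qed.

Lemma mxpd_inv p i (A : 'rV[R]_n -> 'M[R]_p) :
  (forall y, U y -> A y \in unitmx) -> mxsmooth A ->
  mxpd i (fun y => invmx (A y)) x = - (invmx (A x) *m mxpd i A x *m invmx (A x)).
Proof.
move=> uA sA.
(* Differentiate the product of the inverse with [A], which is constant on [U]. *)
have : mxpd i (fun y => invmx (A y) *m A y) x = 0.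
  rewrite -[RHS](mxpd_cst i (1%:M : 'M[R]_p)).
  by apply: eq_mxpd => y Uy; rewrite mulVmx ?uA.
rewrite mxpdM//; last exact: mxsmooth_inv.
move/eqP; rewrite addr_eq0 => /eqP e.
by rewrite -mulNmx -e mulmxK// uA.
Qed.

End MatrixDerivatives.

Section MatrixAbel.
Variables (R : nzRingType) (p q : nat).
Implicit Types A B : 'M[R]_(p, q).

Lemma mxDE A B i j : (A + B) i j = A i j + B i j. Proof. by rewrite mxE. Qed.
Lemma mxNE A i j : (- A) i j = - A i j. Proof. by rewrite mxE. Qed.
Lemma mxZE c A i j : (c *: A) i j = c * A i j. Proof. by rewrite mxE. Qed.
Lemma mx0E i j : (0 : 'M[R]_(p, q)) i j = 0. Proof. by rewrite mxE. Qed.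

Lemma mxTE A i j : A^T i j = A j i. Proof. by rewrite mxE. Qed.

Lemma trmx_add A B : (A + B)^T = A^T + B^T.
Proof. by rewrite linearD. Qed.

Lemma trmx_opp A : (- A)^T = - A^T.
Proof. by rewrite linearN. Qed.

End MatrixAbel.

(** For identities that hold in the additive group once products are expanded: each matrix product
    is kept whole, its entry becomes an opaque scalar, and [ring] compares the sums. *)
Ltac mxabel :=
  let a := fresh "a" in let b := fresh "b" in
  apply/matrixP => a b; rewrite ?(mxDE, mxNE, mxZE, mx0E);
  repeat match goal with
  | |- context [@fun_of_matrix ?T ?p ?q ?X a b] => move: (@fun_of_matrix T p q X a b) => ?
  end;
  ring.

(** The Levi-Civita connection form on the [i]-th coordinate field, as a matrix acting on columns of
    vector components. *)
HB.lock Definition conn (R : realType) (n : nat) (g : 'rV[R]_n -> 'M[R]_n)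
  (i : 'I_n) (x : 'rV[R]_n) : 'M[R]_n := \matrix_(k, m) christoffel g k i m x.

Section LeviCivita.
Variables (R : realType) (n : nat) (U : set 'rV[R]_n) (g : 'rV[R]_n -> 'M[R]_n).
Hypothesis oU : open U.
Hypothesis g_smooth : mxsmooth U g.
Hypothesis g_sym : forall x, U x -> (g x)^T = g x.
Hypothesis g_unit : forall x, U x -> g x \in unitmx.

(** Christoffel symbols of the first kind. *)
Definition conn_low (i : 'I_n) (x : 'rV[R]_n) : 'M[R]_n :=
  \matrix_(l, j) (2^-1 * (mxpd i g x j l + mxpd j g x i l - mxpd l g x i j)).

Lemma conn_lowE i x l j : conn_low i x l j =
  2^-1 * (mxpd i g x j l + mxpd j g x i l - mxpd l g x i j).
Proof. by rewrite mxE. Qed.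

Lemma connE i x : conn g i x = invmx (g x) *m conn_low i x.
Proof.
apply/matrixP => k j; rewrite conn.unlock mxE [RHS]mxE /christoffel mulr_sumr; apply: eq_bigr => l _.
by rewrite conn_lowE !mxpdE mulrCA.
Qed.

Lemma mxpd_metric_sym i j k x : U x -> mxpd i g x j k = mxpd i g x k j.
Proof.
move=> Ux; have e : mxpd i (fun y => (g y)^T) x = mxpd i g x.
  by apply: (eq_mxpd oU Ux) => y /g_sym.
by rewrite -{1}e mxpd_tr mxTE.
Qed.

Lemma conn_sym i j k x : U x -> conn g i x k j = conn g j x k i.
Proof.
move=> Ux; rewrite !connE 2!mxE; apply: eq_bigr => l _; rewrite 2!conn_lowE.
by rewrite (mxpd_metric_sym l i j Ux) [mxpd i g x j l + _]addrC.
Qed.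

Lemma mul_metric_conn i x : U x -> g x *m conn g i x = conn_low i x.
Proof. by move=> Ux; rewrite connE mulKVmx // g_unit. Qed.

(** In the sum of [conn_low i] and its transpose, the derivatives of [g] in the other two directions
    cancel. *)
Lemma metric_parallel i x : U x ->
  mxpd i g x = (conn g i x)^T *m g x + g x *m conn g i x.
Proof.
move=> Ux; rewrite -{1}(g_sym Ux) -trmx_mul mul_metric_conn//.
apply/matrixP => k l; rewrite mxDE mxTE !conn_lowE.
rewrite (mxpd_metric_sym i l k)// (mxpd_metric_sym l i k)// (mxpd_metric_sym k i l)//.
by move: (mxpd i g x k l) (mxpd k g x l i) (mxpd l g x k i) => a b c; field.
Qed.

(* Koszul's formula. *)
Lemma levi_civita_unique (C : 'I_n -> 'M[R]_n) x : U x ->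
  (forall i j k, C i k j = C j k i) ->
  (forall i, mxpd i g x = (C i)^T *m g x + g x *m C i) ->
  forall i, conn g i x = C i.
Proof.
move=> Ux Csym Cg i; rewrite connE -[RHS](mulKmx (g_unit Ux)); congr (_ *m _).
have dg a k l : mxpd a g x k l = (g x *m C a) l k + (g x *m C a) k l.
  rewrite Cg mxDE; congr (_ + _).
  by rewrite -{1}(g_sym Ux) -trmx_mul mxTE.
have cs a b k : (g x *m C a) k b = (g x *m C b) k a.
  by rewrite mxE [RHS]mxE; apply: eq_bigr => m _; rewrite Csym.
apply/matrixP => l j; rewrite conn_lowE !dg.
(* Symmetry leaves three distinct terms among six; two of them cancel, and the third occurs
   twice. *)
rewrite (cs j i l) (cs l i j) (cs l j i).
move: ((g x *m C i) l j) ((g x *m C i) j l) ((g x *m C j) i l) => a b c.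
by field.
Qed.

End LeviCivita.

(** * Curvature and the second Bianchi identity *)

Section Curvature.
Variables (R : realType) (n : nat) (U : set 'rV[R]_n).
Hypothesis oU : open U.

(** The field strength of an arbitrary family [A], since it is also taken of a connection pulled
    back from another chart. *)
Definition curv (A : 'I_n -> 'rV[R]_n -> 'M[R]_n) (i j : 'I_n) (x : 'rV[R]_n) :
    'M[R]_n :=
  mxpd i (A j) x + - mxpd j (A i) x + A i x *m A j x + - (A j x *m A i x).

Lemma riemannE (g : 'rV[R]_n -> 'M[R]_n) k l i j x :
  riemann g k l i j x = curv (conn g) i j x k l.
Proof.
have cE a b : (fun y => conn g a y k b) = christoffel g k a b.
  by apply/funext => y; rewrite conn.unlock mxE.
have cE' a b c : conn g a x b c = christoffel g b a c x.
  by rewrite conn.unlock mxE.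
rewrite /curv !mxDE !mxNE !mxpdE !cE /riemann sumrB -[RHS]addrA.
by congr (_ + (_ - _)); rewrite [RHS]mxE; apply: eq_bigr => m _; rewrite !cE'.
Qed.

Lemma ricciE (g : 'rV[R]_n -> 'M[R]_n) x j l :
  ricci g x j l = \sum_k curv (conn g) k j x k l.
Proof. by rewrite mxE; apply: eq_bigr => k _; rewrite riemannE. Qed.

Lemma curvN A i j x : curv A j i x = - curv A i j x.
Proof. by rewrite /curv; mxabel. Qed.

Variable A : 'I_n -> 'rV[R]_n -> 'M[R]_n.
Hypothesis A_smooth : forall i, mxsmooth U (A i).

Lemma curv_smooth i j : mxsmooth U (curv A i j).
Proof.
rewrite /curv; apply: mxsmoothD => //; last first.
  by apply: mxsmoothN => //; apply: mxsmoothM.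
apply: mxsmoothD => //; last exact: mxsmoothM.
by apply: mxsmoothD => //; [|apply: mxsmoothN => //]; apply: mxsmooth_pd.
Qed.

Lemma mxpd_curv i j k x : U x -> mxpd i (curv A j k) x =
  mxpd i (mxpd j (A k)) x + - mxpd i (mxpd k (A j)) x
  + (mxpd i (A j) x *m A k x + A j x *m mxpd i (A k) x)
  + - (mxpd i (A k) x *m A j x + A k x *m mxpd i (A j) x).
Proof.
move=> Ux; rewrite {1}/curv.
have sp a b : mxsmooth U (mxpd a (A b)) by exact: mxsmooth_pd.
have sm a b : mxsmooth U (fun y => A a y *m A b y) by exact: mxsmoothM.
have s1 := mxsmoothN oU (sp k j); have s2 := mxsmoothN oU (sm k j).
have s3 := mxsmoothD oU (sp j k) s1; have s4 := mxsmoothD oU s3 (sm j k).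
rewrite (mxpdD Ux _ s4 s2) (mxpdD Ux _ s3 (sm j k)) (mxpdD Ux _ (sp j k) s1).
rewrite (mxpdN Ux _ (sp k j)) (mxpdN Ux _ (sm k j)).
by rewrite (mxpdM Ux _ (A_smooth j) (A_smooth k)) (mxpdM Ux _ (A_smooth k) (A_smooth j)).
Qed.

(* [D] omits the Christoffel terms of the covariant derivative that act on the
   indices [b c]: by the symmetry of the connection they cancel in the cyclic
   sum. *)
Lemma bianchi i j k x : U x ->
  let D a b c := mxpd a (curv A b c) x + A a x *m curv A b c x
                 + - (curv A b c x *m A a x) in
  D i j k + D j k i + D k i j = 0.
Proof.
move=> Ux D; rewrite /D !mxpd_curv// /curv.
rewrite (mxpdC oU Ux j i (A_smooth k)) (mxpdC oU Ux k j (A_smooth i)).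
rewrite (mxpdC oU Ux k i (A_smooth j)).
rewrite !(mulmxDl, mulmxDr, mulNmx, mulmxN, mulmxA).
by mxabel.
Qed.

End Curvature.

(** * Curvature of the Levi-Civita connection, with an index raised *)

Section MetricCurvature.
Variables (R : realType) (n : nat) (U : set 'rV[R]_n) (g : 'rV[R]_n -> 'M[R]_n).
Hypothesis oU : open U.
Hypothesis g_smooth : mxsmooth U g.
Hypothesis g_sym : forall x, U x -> (g x)^T = g x.
Hypothesis g_unit : forall x, U x -> g x \in unitmx.

Lemma conn_smooth i : mxsmooth U (conn g i).
Proof.
have -> : conn g i = fun x => invmx (g x) *m conn_low g i x.
  by apply/funext => x; rewrite connE.
apply: mxsmoothM => //; first exact: mxsmooth_inv.
move=> l j; under eq_fun do rewrite conn_lowE !mxpdE.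
have sp a b c : smooth_on U (pd a (fun y => g y b c)) by exact/smooth_on_pd/g_smooth.
apply: smooth_onM => //; first exact: smooth_on_cst.
by apply: smooth_onB => //; apply: smooth_onD.
Qed.

Let A i := conn g i.
Let Rm i j := curv (conn g) i j.

(** Integrability condition of [metric_parallel]: substituting it into the equality of the mixed
    second derivatives of [g] leaves exactly this expression. *)
Lemma curv_metric i j x : U x -> (Rm i j x)^T *m g x + g x *m Rm i j x = 0.
Proof.
move=> Ux; pose H a x := (A a x)^T *m g x + g x *m A a x.
have sA a : mxsmooth U (A a) by exact: conn_smooth.
have sAT a : mxsmooth U (fun x => (A a x)^T) by exact: mxsmooth_tr.
have s1 a := mxsmoothM oU (sAT a) g_smooth.
have s2 a := mxsmoothM oU g_smooth (sA a).
have H2 a b : mxpd a (mxpd b g) x =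
    (mxpd a (A b) x)^T *m g x + (A b x)^T *m mxpd a g x
    + (mxpd a g x *m A b x + g x *m mxpd a (A b) x).
  rewrite (_ : mxpd a (mxpd b g) x = mxpd a (H b) x); last first.
    by apply: (eq_mxpd oU Ux) => y Uy; exact: (metric_parallel oU).
  rewrite (mxpdD Ux _ (s1 b) (s2 b)) (mxpdM Ux _ (sAT b) g_smooth).
  by rewrite (mxpdM Ux _ g_smooth (sA b)) mxpd_tr.
have := mxpdC oU Ux i j g_smooth; rewrite !H2.
rewrite !(metric_parallel oU g_sym g_unit _ Ux) -/(A i) -/(A j).
move/eqP; rewrite -subr_eq0 => /eqP E; rewrite -[RHS]E /Rm /curv -/(A i) -/(A j).
rewrite !(trmx_add, trmx_opp) !trmx_mul.
rewrite !(mulmxDl, mulmxDr, mulNmx, mulmxN, mulmxA).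
by mxabel.
Qed.

(* Entry [(k, l)] is [R^(k l)_(i j)]: in this form the curvature is an
   antisymmetric matrix. *)
Definition curvup i j x := Rm i j x *m invmx (g x).

Lemma curvup_antisym_lr i j x : curvup j i x = - curvup i j x.
Proof. by rewrite /curvup /Rm curvN mulNmx. Qed.

Lemma curvup_antisym i j x : U x -> (curvup i j x)^T = - curvup i j x.
Proof.
move=> Ux; have /(congr1 (fun M => invmx (g x) *m M *m invmx (g x))) := curv_metric i j Ux.
rewrite mulmxDr mulmxDl mulmx0 mul0mx mulmxA mulmxK ?g_unit// mulKmx ?g_unit//.
by move/eqP; rewrite addr_eq0 => /eqP <-; rewrite trmx_mul trmx_inv g_sym.
Qed.

Lemma inv_metric_parallel i x : U x -> mxpd i (fun y => invmx (g y)) x =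
  - (invmx (g x) *m (A i x)^T + A i x *m invmx (g x)).
Proof.
move=> Ux; rewrite (mxpd_inv oU Ux _ g_unit g_smooth) (metric_parallel oU g_sym g_unit _ Ux) -/(A i).
by rewrite mulmxDr mulmxDl !mulmxA mulmxK ?g_unit// mulVmx ?g_unit// mul1mx.
Qed.

Lemma curvup_smooth i j : mxsmooth U (curvup i j).
Proof.
apply: mxsmoothM => //; last exact: mxsmooth_inv.
by apply: curv_smooth => // k; exact: conn_smooth.
Qed.

(** The inverse metric is parallel, so each cyclic term is the one of [bianchi] times [invmx (g x)].
    Both matrix indices are now upper, hence the transpose in the last summand. *)
Lemma bianchi_up i j k x : U x ->
  let D a b c := mxpd a (curvup b c) x + A a x *m curvup b c x
                 + curvup b c x *m (A a x)^T in
  D i j k + D j k i + D k i j = 0.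
Proof.
move=> Ux D.
have sR b c : mxsmooth U (Rm b c) by apply: curv_smooth => // m; exact: conn_smooth.
have sI : mxsmooth U (fun y => invmx (g y)) by exact: mxsmooth_inv.
have DE a b c : D a b c = (mxpd a (Rm b c) x + A a x *m Rm b c x
    + - (Rm b c x *m A a x)) *m invmx (g x).
  rewrite /D {1}/curvup (mxpdM Ux _ (sR b c) sI) inv_metric_parallel// /curvup.
  rewrite !(mulmxDl, mulmxDr, mulNmx, mulmxN, mulmxA, opprD).
  by mxabel.
by rewrite !DE -!mulmxDl (bianchi oU conn_smooth) // mul0mx.
Qed.

End MetricCurvature.

(* The double trace of the second Bianchi identity, written with explicit
   components: [b j k p q] stands for the curvature with its last index raised,
   [db i] for its i-th partial derivative, [G k i j] for the Christoffel
   symbols. The terms in [G] cancel. *)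
Lemma contracted_bianchi (R : comNzRingType) (n : nat)
    (b : 'I_n -> 'I_n -> 'I_n -> 'I_n -> R)
    (db : 'I_n -> 'I_n -> 'I_n -> 'I_n -> 'I_n -> R)
    (G : 'I_n -> 'I_n -> 'I_n -> R) (phi : R) (dphi : 'I_n -> R) :
  (forall x : R, x = - x -> x = 0) ->
  (forall i j k, G k i j = G k j i) ->
  (forall i j p q, b j i p q = - b i j p q) ->
  (forall i j p q, b i j q p = - b i j p q) ->
  (forall i j k p q, db i k j p q = - db i j k p q) ->
  (forall i j k p q, db i j k q p = - db i j k p q) ->
  (forall j q, \sum_k b k j k q = phi * (j == q)%:R) ->
  (forall i j q, \sum_k db i k j k q = dphi i * (j == q)%:R) ->
  let D i j k p q := db i j k p q + \sum_m G p i m * b j k m q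
                     + \sum_m b j k p m * G q i m in
  (forall i j k p q, D i j k p q + D j k i p q + D k i j p q = 0) ->
  forall j, n%:R * dphi j = 2 * dphi j.
Proof.
move=> two Gs b1 b2 db1 db2 tb tdb D Bi j.
have nE (c : R) : n%:R * c = \sum_(i < n) c.
  by rewrite sumr_const card_ord mulr_natl.
have delta (F : 'I_n -> R) a : \sum_i F i * (a == i)%:R = F a.
  rewrite (bigD1 a)//= eqxx mulr1 big1 ?addr0// => i /negPf; rewrite eq_sym => ->.
  by rewrite mulr0.
have tb' k q : \sum_i b k i i q = - (phi * (k == q)%:R).
  by rewrite -tb -sumrN; apply: eq_bigr => i _; rewrite b1.
have tb2 i m : \sum_k b k i m k = - (phi * (i == m)%:R).
  by rewrite -tb -sumrN; apply: eq_bigr => k _; rewrite b2.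
(* This kills the terms in which both lower indices of [G] meet an antisymmetric pair of [b]. *)
have antisym0 (S T : 'I_n -> 'I_n -> R) : (forall a c, S a c = S c a) ->
    (forall a c, T a c = - T c a) -> \sum_a \sum_c S a c * T a c = 0.
  move=> Ss Ta; apply: two; rewrite {1}exchange_big/= -sumrN; apply: eq_bigr => a _.
  by rewrite -sumrN; apply: eq_bigr => c _; rewrite Ss Ta mulrN.
have tb3 m : \sum_k b j k m k = phi * (j == m)%:R.
  by rewrite -tb; apply: eq_bigr => k _; rewrite b1 b2 opprK.
(* Each of the six traced connection terms is [0] or plus or minus [phi * sigma]: [T1] and [T6]
   cancel against [T3] and [T4]. *)
pose sigma := \sum_i G i i j.
have S1 : \sum_i \sum_k db i j k i k = dphi j.
  rewrite -[RHS](delta dphi); apply: eq_bigr => i _; rewrite -tdb.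
  by apply: eq_bigr => k _; rewrite db1 db2 opprK.
have S2 : \sum_i \sum_k db j k i i k = - (n%:R * dphi j).
  rewrite nE -sumrN; apply: eq_bigr => i _.
  have := tdb j i i; rewrite eqxx mulr1 => <-; rewrite -sumrN.
  by apply: eq_bigr => k _; rewrite db2.
have S3 : \sum_i \sum_k db k i j i k = dphi j.
  by rewrite exchange_big/= -[RHS](delta dphi); apply: eq_bigr => k _; rewrite -tdb.
have T1 : \sum_i \sum_k \sum_m G i i m * b j k m k = phi * sigma.
  rewrite mulr_sumr; apply: eq_bigr => i _; rewrite exchange_big/= -[RHS](delta (fun m => phi * G i i m)).
  by apply: eq_bigr => m _; rewrite -mulr_sumr tb3 mulrCA mulrA.
have T2 : \sum_i \sum_k \sum_m b j k i m * G k i m = 0.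
  rewrite exchange_big/= big1// => k _.
  rewrite -[RHS](antisym0 (G k) (b j k))//.
  by apply: eq_bigr => a _; apply: eq_bigr => c _; rewrite mulrC.
have T3 : \sum_i \sum_k \sum_m G i j m * b k i m k = - (phi * sigma).
  rewrite mulr_sumr -sumrN; apply: eq_bigr => i _.
  rewrite exchange_big/= Gs -[RHS]mulNr -[RHS](delta (fun m => - phi * G i j m)).
  by apply: eq_bigr => m _; rewrite -mulr_sumr tb2; ring.
have T4 : \sum_i \sum_k \sum_m b k i i m * G k j m = - (phi * sigma).
  rewrite exchange_big/= mulr_sumr -sumrN; apply: eq_bigr => k _.
  rewrite exchange_big/= Gs -[RHS]mulNr -[RHS](delta (fun m => - phi * G k j m)).
  by apply: eq_bigr => m _; rewrite -mulr_suml tb'; ring.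
have T5 : \sum_i \sum_k \sum_m G i k m * b i j m k = 0.
  rewrite big1// => i _.
  by apply: (antisym0 (G i) (fun k m => b i j m k)).
have T6 : \sum_i \sum_k \sum_m b i j i m * G k k m = phi * sigma.
  rewrite exchange_big/= mulr_sumr; apply: eq_bigr => k _.
  rewrite exchange_big/= -[RHS](delta (fun m => phi * G k k m)).
  by apply: eq_bigr => m _; rewrite -mulr_suml tb; ring.
(* The double trace contracts [p] with [i] and [q] with [k]. *)
have : \sum_i \sum_k (D i j k i k + D j k i i k + D k i j i k) = 0.
  by rewrite big1// => i _; rewrite big1.
rewrite /D; under eq_bigr => i _ do rewrite !big_split/=.
rewrite !big_split/= S1 S2 S3 T1 T2 T3 T4 T5 T6 => E.
by apply/eqP; rewrite -subr_eq0 -oppr_eq0 -E; apply/eqP; ring.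
Qed.

(** Put [q = j] in the last hypothesis and sum over [j]: the right side gives [(n - 1) dpsi], while
    antisymmetry turns the left side into minus the Ricci trace applied to [w]. *)
Lemma contracted_hessian (R : comNzRingType) (n : nat)
    (b : 'I_n -> 'I_n -> 'I_n -> 'I_n -> R) (phi : R) (w dpsi : 'I_n -> R) :
  (forall i j p q, b i j q p = - b i j p q) ->
  (forall j q, \sum_k b k j k q = phi * (j == q)%:R) ->
  (forall i j q, \sum_p w p * b j i p q =
     dpsi i * (j == q)%:R - dpsi j * (i == q)%:R) ->
  forall i, (n%:R - 1) * dpsi i = - (phi * w i).
Proof.
move=> b2 tb H i.
have nE (c : R) : n%:R * c = \sum_(i < n) c.
  by rewrite sumr_const card_ord mulr_natl.
have delta (F : 'I_n -> R) a : \sum_i F i * (a == i)%:R = F a.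
  rewrite (bigD1 a)//= eqxx mulr1 big1 ?addr0// => k /negPf; rewrite eq_sym => ->.
  by rewrite mulr0.
have : \sum_j \sum_p w p * b j i p j = n%:R * dpsi i - dpsi i.
  rewrite -{2}(delta dpsi i) nE -sumrB.
  by apply: eq_bigr => j _; rewrite H eqxx mulr1.
rewrite mulrBl mul1r => <-; rewrite exchange_big/= -mulNr -(delta (fun p => - phi * w p)).
apply: eq_bigr => p _; rewrite -mulr_sumr.
transitivity (w p * - (phi * (i == p)%:R)); last by ring.
by rewrite -tb -sumrN; congr (_ * _); apply: eq_bigr => j _; rewrite b2.
Qed.

(** * Einstein metrics in a chart *)

Section EinsteinChart.
Variables (R : realType) (n : nat) (U : set 'rV[R]_n) (g : 'rV[R]_n -> 'M[R]_n).
Hypothesis oU : open U.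
Hypothesis g_smooth : mxsmooth U g.
Hypothesis g_sym : forall x, U x -> (g x)^T = g x.
Hypothesis g_unit : forall x, U x -> g x \in unitmx.
Variable phi : 'rV[R]_n -> R.
Hypothesis ricci_phi : forall x, U x -> ricci g x = phi x *: g x.

Lemma curvup_trace j q x : U x ->
  \sum_k curvup g k j x k q = phi x * (j == q)%:R.
Proof.
move=> Ux; transitivity ((ricci g x *m invmx (g x)) j q).
  rewrite mxE /curvup; under eq_bigr => k _ do rewrite mxE.
  rewrite exchange_big/=; apply: eq_bigr => l _.
  by rewrite ricciE mulr_suml.
by rewrite ricci_phi// -scalemxAl mulmxV ?g_unit// mxZE mxE.
Qed.

(** No regularity of [phi] is assumed; it is read off as a diagonal entry of the mixed Ricci tensor,
    and [i] selects the entry. *)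
Lemma einstein_factor_smooth (i : 'I_n) : smooth_on U phi.
Proof.
apply: (@eq_smooth_on _ _ U oU (fun x => \sum_k curvup g k i x k i)).
  by move=> x; rewrite inE => Ux; rewrite curvup_trace// eqxx mulr1.
by apply: smooth_on_sum => // k; exact: (curvup_smooth oU g_smooth g_unit).
Qed.

Lemma schur_chart j x : U x -> n%:R * pd j phi x = 2 * pd j phi x.
Proof.
move=> Ux; have sphi := einstein_factor_smooth j.
have two (a : R) : a = - a -> a = 0.
  move/eqP; rewrite -subr_eq0 opprK -mulr2n mulrn_eq0/= => /eqP //.
have cs a b := curvup_smooth oU g_smooth g_unit a b.
apply: (@contracted_bianchi R n (fun a b p q => curvup g a b x p q)
  (fun i a b p q => mxpd i (curvup g a b) x p q)
  (fun k i m => conn g i x k m) (phi x) (fun i => pd i phi x) two).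
- by move=> i a k; exact: (conn_sym oU g_sym).
- by move=> i a p q; rewrite curvup_antisym_lr mxNE.
- by move=> i a p q; rewrite -mxNE -(curvup_antisym oU g_smooth g_sym g_unit) // mxTE.
- move=> i a k p q; rewrite -mxNE -(mxpdN Ux _ (cs a k)); congr (fun_of_matrix _ _ _).
  by apply: (eq_mxpd oU Ux) => y _; rewrite curvup_antisym_lr.
- move=> i a k p q; rewrite -mxNE -(mxpdN Ux _ (cs a k)).
  rewrite -(mxTE (mxpd i _ x)) -mxpd_tr; congr (fun_of_matrix _ _ _).
  apply: (eq_mxpd oU Ux) => y Uy.
  by rewrite -(curvup_antisym oU g_smooth g_sym g_unit) // trmxK.
- by move=> a q; exact: curvup_trace.
- move=> i a q; transitivity (pd i (fun y => \sum_k curvup g k a y k q) x).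
    rewrite pd_sum; first by apply: eq_bigr => k _; rewrite mxpdE.
    by move=> k; apply: smooth_on_differentiable Ux; exact: cs.
  transitivity (pd i (fun y => phi y * (a == q)%:R) x).
    by apply: (eq_on_pd _ oU Ux) => y; rewrite inE => Uy; exact: curvup_trace.
  rewrite pdM; [|exact: smooth_on_differentiable Ux|exact: differentiable_cst].
  by rewrite pd_cst mulr0 addr0.
- move=> i a k p q; have := bianchi_up oU g_smooth g_sym g_unit i a k Ux.
  move/(congr1 (fun M : 'M[R]_n => M p q)); rewrite mx0E => E; rewrite -[RHS]E.
  rewrite !mxDE; congr (_ + _ + _); congr (_ + _ + _); rewrite [RHS]mxE//;
    by apply: eq_bigr => m _; rewrite mxTE.
Qed.

Variables F psi : 'rV[R]_n -> R.
Hypotheses (F_smooth : smooth_on U F) (psi_smooth : smooth_on U psi).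
Hypothesis hessian_psi : forall x, U x -> hessian g F x = psi x *: g x.

Lemma dcoord_smooth : mxsmooth U (dcoord F).
Proof. by move=> k l; under eq_fun do rewrite mxE; exact: smooth_on_pd. Qed.

Let e (i : 'I_n) : 'rV[R]_n := delta_mx 0 i.

(** The Hessian equation as a first-order linear system for the row [dF], ready to be differentiated
    once more. *)
Lemma mxpd_dcoord i x : U x ->
  mxpd i (dcoord F) x = dcoord F x *m conn g i x + psi x *: (e i *m g x).
Proof.
move=> Ux; apply/rowP => j; rewrite mxpdE mxDE mxZE.
have -> : (fun y => dcoord F y 0 j) = pd j F by apply/funext => y; rewrite mxE.
have -> : (e i *m g x) 0 j = g x i j by rewrite -rowE mxE.
have : hessian g F x i j = psi x * g x i j by rewrite hessian_psi// mxZE.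
rewrite mxE => <-; rewrite addrCA [X in _ + (X - _)]mxE.
rewrite (_ : \sum_k _ = \sum_k christoffel g k i j x * pd k F x) ?subrr ?addr0//.
by apply: eq_bigr => k _; rewrite conn.unlock !mxE mulrC.
Qed.

(** Integrability condition of [mxpd_dcoord], that is, the Ricci identity for [dF]: the terms in
    [psi] cancel because the metric is parallel and the connection is torsion-free, and only
    derivatives of [psi] remain. *)
Lemma dcoord_curvup i j x : U x ->
  dcoord F x *m curvup g j i x = pd i psi x *: e j - pd j psi x *: e i.
Proof.
move=> Ux; have sw := dcoord_smooth.
have sA a : mxsmooth U (conn g a) by exact: conn_smooth.
have se a : mxsmooth U (fun y => e a *m g y).
  by apply: mxsmoothM => //; exact: mxsmooth_cst.
have s1 a := mxsmoothM oU sw (sA a).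
have s2 a := mxsmoothZ oU psi_smooth (se a).
have H2 a c : mxpd a (mxpd c (dcoord F)) x =
    mxpd a (dcoord F) x *m conn g c x + dcoord F x *m mxpd a (conn g c) x
    + (pd a psi x *: (e c *m g x) + psi x *: (e c *m mxpd a g x)).
  rewrite (_ : mxpd a (mxpd c (dcoord F)) x = mxpd a (fun y =>
     dcoord F y *m conn g c y + psi y *: (e c *m g y)) x); last first.
    by apply: (eq_mxpd oU Ux) => y Uy; exact: mxpd_dcoord.
  rewrite (mxpdD Ux _ (s1 c) (s2 c)) (mxpdM Ux _ sw (sA c)).
  rewrite (mxpdZ Ux _ psi_smooth (se c)) (mxpdM Ux _ (mxsmooth_cst oU (e c)) g_smooth).
  by rewrite mxpd_cst mul0mx add0r.
(* Torsion-freeness, in the form in which it meets the derivative of the metric. *)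
have tf : e i *m (conn g j x)^T = e j *m (conn g i x)^T.
  by apply/rowP => k; rewrite -!rowE mxE mxTE [RHS]mxE mxTE (conn_sym oU g_sym).
have := mxpdC oU Ux j i sw; rewrite !H2 !mxpd_dcoord//.
rewrite !(metric_parallel oU g_sym g_unit _ Ux).
move/eqP; rewrite -subr_eq0 => /eqP E.
suff : dcoord F x *m curv (conn g) j i x =
    (pd i psi x *: e j - pd j psi x *: e i) *m g x.
  by rewrite /curvup mulmxA => ->; rewrite mulmxK ?g_unit.
apply/eqP; rewrite -subr_eq0; apply/eqP; rewrite -[RHS]E /curv.
rewrite !(mulmxDl, mulmxDr, mulNmx, mulmxN, mulmxA) tf -!scalemxAl.
by mxabel.
Qed.

Lemma concircular_chart i x : U x ->
  (n%:R - 1) * pd i psi x = - (phi x * pd i F x).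
Proof.
move=> Ux; apply: (@contracted_hessian R n (fun a b p q => curvup g a b x p q)
  (phi x) (fun p => pd p F x) (fun p => pd p psi x)).
- by move=> a c p q; rewrite -mxNE -(curvup_antisym oU g_smooth g_sym g_unit) // mxTE.
- by move=> a q; exact: curvup_trace.
move=> a c q; have := dcoord_curvup a c Ux.
have eE d : e d 0 q = (d == q)%:R by rewrite mxE eqxx eq_sym.
move/(congr1 (fun M : 'rV[R]_n => M 0 q)); rewrite mxDE mxNE !mxZE !eE => <-.
rewrite [RHS]mxE; apply: eq_bigr => p _; congr (_ * _).
by rewrite [RHS]mxE.
Qed.

End EinsteinChart.

(** * Change of coordinates *)

Section ChangeOfCoordinates.
Variables (R : realType) (n : nat) (U V : set 'rV[R]_n).
Variables (y : 'rV[R]_n -> 'rV[R]_n) (g h : 'rV[R]_n -> 'M[R]_n).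
Hypotheses (oU : open U) (oV : open V).
Hypothesis yUV : forall x, U x -> V (y x).
Hypothesis y_smooth : forall k, smooth_on U (fun x => y x 0 k).

Lemma smooth_on_comp F : smooth_on V F -> smooth_on U (fun x => F (y x)).
Proof.
move=> /smooth_onP sF; apply/smooth_onP => // k.
elim: k F {sF}(sF k) => // k IH F [dF kF]; split=> [x Ux|i].
  apply: differentiable_chain; last exact/dF/yUV.
  by move=> m; exact: smooth_on_differentiable Ux.
have ky m : Ck U k (pd i (fun x => y x 0 m)).
  by have /smooth_onP := smooth_on_pd i (y_smooth m).
have kS : Ck U k (fun x => \sum_m pd i (fun x => y x 0 m) x * pd m F (y x)).
  have : forall s : seq 'I_n,
      Ck U k (fun x => \sum_(m <- s) pd i (fun x => y x 0 m) x * pd m F (y x)).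
    elim=> [|m s IHs].
      by under eq_fun do rewrite big_nil; exact: Ck_cst.
    under eq_fun do rewrite big_cons.
    by apply: CkD => //; apply: CkM => //; exact: (IH (pd m F) (kF m)).
  exact.
apply: (eq_Ck oU _ kS) => x; rewrite inE => Ux; rewrite pd_chain//.
  by move=> m; exact: smooth_on_differentiable Ux.
exact/dF/yUV.
Qed.

Definition jac (x : 'rV[R]_n) : 'M[R]_n :=
  \matrix_(i, k) pd i (fun z => y z 0 k) x.

Hypotheses (g_smooth : mxsmooth U g) (h_smooth : mxsmooth V h).
Hypotheses (g_sym : forall x, U x -> (g x)^T = g x)
  (h_sym : forall x, V x -> (h x)^T = h x).
Hypotheses (g_unit : forall x, U x -> g x \in unitmx)
  (h_unit : forall x, V x -> h x \in unitmx).
Hypothesis gh : forall x, U x -> g x = jac x *m h (y x) *m (jac x)^T.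

(** The gauge transformation: [P] sends the components of a tangent vector in the first chart to
    those in the second. *)
Let P x := (jac x)^T.
(** The connection form of [h] pulled back along [y], still expressed in the frame of the second
    chart. *)
Let pullback_conn i x := \sum_m P x m i *: conn h m (y x).

Lemma jacTE x k i : P x k i = pd i (fun z => y z 0 k) x.
Proof. by rewrite !mxE. Qed.

Lemma jacT_smooth : mxsmooth U P.
Proof. by move=> k i; under eq_fun do rewrite jacTE; exact: smooth_on_pd. Qed.

Lemma mxsmooth_comp (p q : nat) (B : 'rV[R]_n -> 'M[R]_(p, q)) :
  mxsmooth V B -> mxsmooth U (fun x => B (y x)).
Proof. by move=> sB k l; exact: (smooth_on_comp (sB k l)). Qed.

Lemma jacT_unit x : U x -> P x \in unitmx.
Proof.
move=> Ux; have := g_unit Ux; rewrite gh// unitmx_mul => /andP[_].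
by [].
Qed.

Lemma mxpd_jacT_sym i j k x : U x -> mxpd i P x k j = mxpd j P x k i.
Proof.
move=> Ux; have PE' a : (fun z => P z k a) = pd a (fun z => y z 0 k).
  by apply/funext => z; rewrite jacTE.
by rewrite !mxpdE (PE' i) (PE' j); exact: (smooth_pdC oU i j (y_smooth k) Ux).
Qed.

Lemma mxpd_chain (p q : nat) i (B : 'rV[R]_n -> 'M[R]_(p, q)) x :
  mxsmooth V B -> U x ->
  mxpd i (fun z => B (y z)) x = \sum_m P x m i *: mxpd m B (y x).
Proof.
move=> sB Ux; apply/matrixP => k l; rewrite mxpdE summxE (@pd_chain _ _ _ y (fun w => B w k l)).
- by apply: eq_bigr => m _; rewrite mxZE mxpdE jacTE.
- by move=> m; exact: smooth_on_differentiable Ux.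
- by apply: (smooth_on_differentiable (sB k l)); exact: yUV.
Qed.

Lemma mxsmooth_sum (p q : nat) (B : 'I_n -> 'rV[R]_n -> 'M[R]_(p, q)) :
  (forall m, mxsmooth U (B m)) -> mxsmooth U (fun x => \sum_m B m x).
Proof.
move=> sB k l; under eq_fun do rewrite summxE.
by apply: smooth_on_sum => // m; exact: sB.
Qed.

Lemma mxpd_sum (p q : nat) i (B : 'I_n -> 'rV[R]_n -> 'M[R]_(p, q)) x :
  U x -> (forall m, mxsmooth U (B m)) ->
  mxpd i (fun z => \sum_m B m z) x = \sum_m mxpd i (B m) x.
Proof.
move=> Ux sB; apply/matrixP => k l; rewrite mxpdE summxE.
under [X in pd i X]eq_fun do rewrite summxE.
rewrite pd_sum; first by apply: eq_bigr => m _; rewrite mxpdE.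
by move=> m; exact: (smooth_on_differentiable (sB m k l)).
Qed.

Lemma pullback_conn_smooth i : mxsmooth U (pullback_conn i).
Proof.
apply: mxsmooth_sum => m; apply: mxsmoothZ => //; first exact: jacT_smooth.
by apply: mxsmooth_comp; exact: conn_smooth.
Qed.

(** By uniqueness of the Levi-Civita connection: the gauge transform of the pullback is compatible
    with [g], and it is torsion-free because second derivatives of [y] commute. *)
Lemma conn_change i x : U x -> P x *m conn g i x = pullback_conn i x *m P x + mxpd i P x.
Proof.
move=> Ux; pose N i := pullback_conn i x *m P x + mxpd i P x.
suff -> : conn g i x = invmx (P x) *m N i by rewrite mulKVmx// jacT_unit.
move: i; apply: (levi_civita_unique g_sym g_unit
  (C := fun i => invmx (P x) *m N i) Ux) => [i j k|i].
  rewrite mxE [RHS]mxE; apply: eq_bigr => l _; congr (_ * _).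
  rewrite !mxDE (mxpd_jacT_sym i j l Ux); congr (_ + _).
  rewrite mxE [RHS]mxE.
  have AtP a c : \sum_m pullback_conn a x l m * P x m c =
      \sum_m \sum_r (P x r a * conn h r (y x) l m) * P x m c.
    apply: eq_bigr => m _; rewrite summxE mulr_suml.
    by apply: eq_bigr => r _; rewrite mxZE.
  rewrite !AtP exchange_big/=; apply: eq_bigr => m _; apply: eq_bigr => r _.
  rewrite (conn_sym oV h_sym); last exact: yUV.
  by rewrite mulrAC [RHS]mulrAC [P x _ _ * _]mulrC.
have sP := jacT_smooth; have sPT := mxsmooth_tr sP.
have sh := mxsmooth_comp h_smooth; have s1 := mxsmoothM oU sPT sh.
have -> : mxpd i g x = mxpd i (fun z => (P z)^T *m h (y z) *m P z) x.
  by apply: (eq_mxpd oU Ux) => z Uz; rewrite gh// trmxK.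
rewrite (mxpdM Ux _ s1 sP) (mxpdM Ux _ sPT sh) mxpd_tr mxpd_chain//.
have -> : \sum_m P x m i *: mxpd m h (y x) =
    (pullback_conn i x)^T *m h (y x) + h (y x) *m pullback_conn i x.
  rewrite linear_sum/= mulmx_suml mulmx_sumr -big_split; apply: eq_bigr => m _.
  rewrite (metric_parallel oV h_sym h_unit) ?scalerDr; last exact: yUV.
  by rewrite linearZ/= -scalemxAl -scalemxAr.
have -> : g x = (P x)^T *m h (y x) *m P x by rewrite gh// trmxK.
have uPT : (P x)^T \in unitmx by rewrite unitmx_tr jacT_unit.
rewrite trmx_mul trmx_inv -!mulmxA !(mulKmx (jacT_unit Ux), mulKVmx (jacT_unit Ux)).
rewrite (mulKmx uPT) ?(mulKVmx uPT) /N trmx_add trmx_mul.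
rewrite !(mulmxDl, mulmxDr, mulmxA).
by mxabel.
Qed.

(* Obtained by differentiating [conn_change] and antisymmetrizing. *)
Lemma curv_gauge i j x : U x -> P x *m curv (conn g) i j x = curv pullback_conn i j x *m P x.
Proof.
move=> Ux; have sP := jacT_smooth; have sA a : mxsmooth U (conn g a) by exact: conn_smooth.
have sAt := pullback_conn_smooth.
have D a b : mxpd a P x *m conn g b x + P x *m mxpd a (conn g b) x =
    mxpd a (pullback_conn b) x *m P x + pullback_conn b x *m mxpd a P x + mxpd a (mxpd b P) x.
  rewrite -(mxpdM Ux _ sP (sA b)) -(mxpdM Ux _ (sAt b) sP).
  rewrite -(mxpdD Ux _ (mxsmoothM oU (sAt b) sP) (mxsmooth_pd _ sP)).
  by apply: (eq_mxpd oU Ux) => z Uz; exact: conn_change.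
have D' a b : P x *m mxpd a (conn g b) x = mxpd a (pullback_conn b) x *m P x +
    pullback_conn b x *m mxpd a P x + mxpd a (mxpd b P) x - mxpd a P x *m conn g b x.
  by rewrite -D addrAC subrr add0r.
rewrite /curv !(mulmxDl, mulmxDr, mulNmx, mulmxN) !D' (mxpdC oU Ux j i sP).
rewrite !mulmxA !conn_change// !mulmxDl -!mulmxA !conn_change//.
rewrite !(mulmxDl, mulmxDr, mulmxA).
by mxabel.
Qed.

(** The second derivatives of [y] enter symmetrically in [i] and [j] and drop out. *)
Lemma curv_pullback i j x : U x -> curv pullback_conn i j x =
  \sum_m \sum_l (P x m i * P x l j) *: curv (conn h) m l (y x).
Proof.
move=> Ux; have sc a : mxsmooth V (conn h a) by exact: conn_smooth.
have sc' a := mxsmooth_comp (sc a).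
have sP a b : smooth_on U (fun z => P z a b) := jacT_smooth a b.
have dAt a b : mxpd a (pullback_conn b) x = \sum_l mxpd a P x l b *: conn h l (y x) +
    \sum_m \sum_l (P x m a * P x l b) *: mxpd m (conn h l) (y x).
  rewrite mxpd_sum//; last by move=> m; exact: mxsmoothZ.
  rewrite exchange_big -big_split; apply: eq_bigr => l _.
  rewrite (mxpdZ Ux _ (sP l b) (sc' l)) -mxpdE mxpd_chain// scaler_sumr.
  by congr (_ + _); apply: eq_bigr => m _; rewrite scalerA mulrC.
have AtM a b : pullback_conn a x *m pullback_conn b x =
    \sum_m \sum_l (P x m a * P x l b) *: (conn h m (y x) *m conn h l (y x)).
  rewrite mulmx_suml; apply: eq_bigr => m _; rewrite mulmx_sumr.
  by apply: eq_bigr => l _; rewrite -scalemxAl -scalemxAr scalerA.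
have swap (B : 'I_n -> 'I_n -> 'M[R]_n) :
    \sum_m \sum_l (P x m j * P x l i) *: B m l =
    \sum_m \sum_l (P x m i * P x l j) *: B l m.
  rewrite exchange_big; apply: eq_bigr => l _; apply: eq_bigr => m _.
  by rewrite mulrC.
have -> : \sum_m \sum_l (P x m i * P x l j) *: curv (conn h) m l (y x) =
    \sum_m \sum_l (P x m i * P x l j) *: mxpd m (conn h l) (y x)
    - \sum_m \sum_l (P x m i * P x l j) *: mxpd l (conn h m) (y x)
    + \sum_m \sum_l (P x m i * P x l j) *: (conn h m (y x) *m conn h l (y x))
    - \sum_m \sum_l (P x m i * P x l j) *: (conn h l (y x) *m conn h m (y x)).
  rewrite -sumrB -big_split -sumrB; apply: eq_bigr => m _.
  rewrite -sumrB -big_split -sumrB; apply: eq_bigr => l _.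
  by rewrite /curv !scalerDr !scalerN.
have sym : \sum_l mxpd i P x l j *: conn h l (y x) =
    \sum_l mxpd j P x l i *: conn h l (y x).
  by apply: eq_bigr => l _; rewrite (mxpd_jacT_sym i j l Ux).
rewrite {1}/curv !dAt !AtM !swap sym.
move: (\sum_l mxpd j P x l i *: _) => S0.
move: (\sum_m _) (\sum_m _) (\sum_m _) (\sum_m _) => S1 S2 S3 S4.
by mxabel.
Qed.

(** [curv_gauge] and [curv_pullback] express the curvature of [g] through four factors [P], one of
    them inverted; the trace cancels the inverse against one of the others and leaves two. *)
Lemma ricci_change x : U x -> ricci g x = jac x *m ricci h (y x) *m (jac x)^T.
Proof.
move=> Ux; apply/matrixP => j l; rewrite ricciE.
have uP := jacT_unit Ux.
have cE k : curv (conn g) k j x = invmx (P x) *m (\sum_m \sum_r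
    (P x m k * P x r j) *: curv (conn h) m r (y x)) *m P x.
  by rewrite -curv_pullback// -mulmxA -curv_gauge// mulKmx.
transitivity (\sum_k \sum_m \sum_r \sum_b
   \sum_a (P x m k * invmx (P x) k a) * (P x r j * curv (conn h) m r (y x) a b * P x b l)).
  apply: eq_bigr => k _; rewrite cE.
  transitivity (\sum_m \sum_r ((P x m k * P x r j) *:
     (invmx (P x) *m curv (conn h) m r (y x) *m P x)) k l).
    rewrite mulmx_sumr mulmx_suml summxE; apply: eq_bigr => m _.
    rewrite mulmx_sumr mulmx_suml summxE; apply: eq_bigr => r _.
    by rewrite -scalemxAr -scalemxAl.
  apply: eq_bigr => m _; apply: eq_bigr => r _; rewrite mxZE [X in _ * X]mxE mulr_sumr.
  apply: eq_bigr => b _; rewrite [X in _ * (X * _)]mxE mulr_suml mulr_sumr.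
  by apply: eq_bigr => a _; ring.
rewrite exchange_big/=.
transitivity (\sum_m \sum_r \sum_b (P x r j * curv (conn h) m r (y x) m b * P x b l)).
  apply: eq_bigr => m _; rewrite exchange_big/=; apply: eq_bigr => r _.
  rewrite exchange_big/=; apply: eq_bigr => b _; rewrite exchange_big/=.
  under eq_bigr => a _ do rewrite -mulr_suml.
  have PI a : \sum_k P x m k * invmx (P x) k a = (m == a)%:R.
    by have := mulmxV uP; move/(congr1 (fun M : 'M[R]_n => M m a)); rewrite !mxE.
  under eq_bigr => a _ do rewrite PI.
  rewrite (bigD1 m)//= eqxx mul1r big1 ?addr0// => a /negPf.
  by rewrite eq_sym => ->; rewrite mul0r.
rewrite exchange_big/= -mulmxA mxE; apply: eq_bigr => r _.
rewrite exchange_big/= [X in _ = _ * X]mxE mulr_sumr; apply: eq_bigr => b _.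
rewrite -mulr_suml -mulr_sumr -ricciE mulrA.
by rewrite (_ : jac x j r = P x r j) // mxTE.
Qed.

End ChangeOfCoordinates.

(** * Global consequences *)

Lemma unitmx_neq0 (F : fieldType) (n : nat) (A : 'M[F]_n) :
  (0 < n)%N -> A \in unitmx -> A != 0.
Proof.
by case: n A => // n A _; apply: contraTneq => ->; rewrite unitmxE det0 unitr0.
Qed.

(** * Hessian of an exponential *)

Section HessianExp.
Variables (R : realType) (n : nat) (U : set 'rV[R]_n) (g : 'rV[R]_n -> 'M[R]_n).
Variables (F : 'rV[R]_n -> R) (c : R).
Hypotheses (oU : open U) (F_smooth : smooth_on U F).

Lemma smooth_exp_scale : smooth_on U (fun x => expR (c * F x)).
Proof.
by apply: smooth_on_expR => //; apply: smooth_onM => //; exact: smooth_on_cst.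
Qed.

Lemma pd_exp_scale i x : U x ->
  pd i (fun z => expR (c * F z)) x = c * expR (c * F x) * pd i F x.
Proof.
move=> Ux; have dF := smooth_on_differentiable F_smooth Ux.
have dc : differentiable (fun=> c : R) x by exact: differentiable_cst.
rewrite pd_expR; last exact: differentiableM.
by rewrite pdM// pd_cst mul0r add0r mulrCA mulrA.
Qed.

(** This is why the exponential appears: for [c = mu / beta] the bracket is [beta^-1] times the
    combination of Hessian and squared differential in the structure equation. *)
Lemma hessian_exp_scale x : U x ->
  hessian g (fun z => expR (c * F z)) x =
  (c * expR (c * F x)) *: (hessian g F x + c *: ((dcoord F x)^T *m dcoord F x)).
Proof.
move=> Ux; apply/matrixP => i j.
have -> : ((c * expR (c * F x)) *:
    (hessian g F x + c *: ((dcoord F x)^T *m dcoord F x))) i j =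
    c * expR (c * F x) * (hessian g F x i j + c * (pd i F x * pd j F x)).
  rewrite mxZE mxDE mxZE; congr (_ * (_ + _ * _)).
  by rewrite mxE big_ord_recl big_ord0 addr0 mxTE !mxE.
rewrite mxE [hessian g F x i j]mxE.
have -> : pd i (pd j (fun z => expR (c * F z))) x =
    c * expR (c * F x) * (c * (pd i F x * pd j F x) + pd i (pd j F) x).
  transitivity (pd i (fun z => c * expR (c * F z) * pd j F z) x).
    by apply: (eq_on_pd _ oU Ux) => z; rewrite inE => Uz; exact: pd_exp_scale.
  have dE := smooth_on_differentiable smooth_exp_scale Ux.
  have dc : differentiable (fun=> c : R) x by exact: differentiable_cst.
  rewrite pdM; last 2 first.
  - exact: differentiableM.
  - exact: (smooth_on_differentiable (smooth_on_pd j F_smooth) Ux).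
  rewrite pdM// pd_cst mul0r add0r pd_exp_scale//.
  move: (expR _) (pd i F x) (pd j F x) (pd i (pd j F) x) => a b d e; ring.
have -> : \sum_k christoffel g k i j x * pd k (fun z => expR (c * F z)) x =
    c * expR (c * F x) * \sum_k christoffel g k i j x * pd k F x.
  rewrite mulr_sumr; apply: eq_bigr => k _; rewrite pd_exp_scale//.
  by rewrite mulrCA.
move: (expR _) (pd i F x * _) (pd i (pd j F) x) (\sum_k _) => a b d e; ring.
Qed.

End HessianExp.

(** * From charts to the connected manifold *)

Section Globalization.
Variables (R : realType) (n : nat) (M : topologicalType).
Variables (X : smooth_manifold R n M) (g : riemannian_metric X).

Lemma crange_open (a : idx X) : open (crange a).
Proof. exact: range_open. Qed.

Lemma in_chartE (a : idx X) (F : M -> R) p : dom a p ->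
  in_chart a F (chart a p) = F p.
Proof. by move=> ap; rewrite /in_chart /= chartK. Qed.

Lemma chart_constant (F : M -> R) :
  (forall (a : idx X) x, crange a x -> differentiable (in_chart a F) x) ->
  (forall (a : idx X) x i, crange a x -> pd i (in_chart a F) x = 0) ->
  forall p q, F p = F q.
Proof.
move=> dF F0.
have loc p : \forall q \near p, F q = F p.
  have [a ap] := dom_cover X p.
  have xa : crange a (chart a p) by exists p.
  have nx := pd0_locally_constant (@crange_open a) xa (dF a) (F0 a).
  have ca : {for p, continuous (chart a)}.
    have := @chart_continuous _ _ _ X a.
    rewrite continuous_open_subspace; last exact: dom_open.
    by apply; rewrite inE.
  have na := open_nbhs_nbhs (conj (dom_open a) ap).
  apply: filterS2 na (ca _ nx) => q aq /=.
  by rewrite !in_chartE.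
(* Every preimage under a locally constant function is open, so level sets are open and closed. *)
have oE (Q : set R) : open [set q | Q (F q)].
  rewrite openE => q Qq; rewrite /interior; apply: filterS (loc q) => r e.
  by rewrite /= e.
move=> p q; suff e : [set r | F r = F q] = [set: M].
  by have : [set: M] p by []; rewrite -e.
apply: (mfd_connected X); first by exists q.
- by exists [set r | F r = F q]; [exact: (oE (fun z => z = F q))|rewrite setTI].
- exists [set r | F r = F q]; last by rewrite setTI.
  rewrite -[X in closed X]setCK; apply: open_closedC.
  exact: (oE (fun z => ~ (z = F q))).
Qed.

Lemma metric_unit (a : idx X) x : crange a x -> g a x \in unitmx.
Proof.
move=> ax; rewrite -row_free_unit; apply: inj_row_free => v vg.
apply/eqP; apply: contraT => v0; have := metric_pos g ax v0.
by rewrite vg mul0mx mxE ltxx.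
Qed.

Lemma metric_mxsmooth (a : idx X) : mxsmooth (crange a) (g a).
Proof. by move=> i j; exact: metric_smooth. Qed.

(** The Ricci tensor and the metric transform alike, so on an overlap the two factors multiply the
    same nonzero matrix [g a]. *)
Lemma einstein_factor_change (s : idx X -> 'rV[R]_n -> R) (a b : idx X) p :
  (0 < n)%N -> (forall c x, crange c x -> ricci (g c) x = s c x *: g c x) ->
  dom a p -> dom b p -> s a (chart a p) = s b (chart b p).
Proof.
move=> n0 ricE ap bp.
pose U := chart a @` (dom a `&` dom b).
have Ua x : U x -> crange a x by move=> [q [aq _] <-]; exists q.
have oU : open U.
  rewrite openE => _ [q [aq bq] <-]; rewrite /interior.
  have xa : crange a (chart a q) by exists q.
  have ca : {for chart a q, continuous (param a)}.
    have := @param_continuous _ _ _ X a.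
    rewrite continuous_open_subspace; last exact: range_open.
    by apply; rewrite inE.
  have nb : nbhs (param a (chart a q)) (dom b).
    by rewrite chartK//; exact: open_nbhs_nbhs (conj (dom_open b) bq).
  have na := open_nbhs_nbhs (conj (@crange_open a) xa).
  apply: filterS2 na (ca _ nb) => _ [r ar <-] /= br.
  by exists r => //; split=> //; rewrite chartK in br.
pose y x := chart b (param a x).
have yUV x : U x -> crange b (y x).
  by move=> [q [aq bq] <-]; rewrite /y chartK//; exists q.
have ys k : smooth_on U (fun x => y x 0 k) by exact: transition_smooth.
have gh x : U x -> g a x = jac y x *m g b (y x) *m (jac y x)^T.
  by move=> [q [aq bq] <-]; rewrite /y chartK// (metric_compat g aq bq).
have Ux : U (chart a p) by exists p.
have yp : y (chart a p) = chart b p by rewrite /y chartK.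
have gaU : mxsmooth U (g a).
  by move=> i j; apply: smooth_on_sub (@metric_mxsmooth a i j).
have := ricci_change oU (@crange_open b) yUV ys gaU (@metric_mxsmooth b)
  (fun x Ux => Defs.metric_sym g (Ua x Ux)) (fun x bx => Defs.metric_sym g bx)
  (fun x Ux => metric_unit (Ua x Ux)) (fun x bx => metric_unit bx) gh Ux.
rewrite !ricE; [|exact: yUV|exact: Ua].
rewrite -scalemxAr -scalemxAl -gh// yp => /eqP.
rewrite -subr_eq0 -scalerBl scaler_eq0 subr_eq0 => /orP[/eqP //|/eqP g0].
by have := unitmx_neq0 n0 (metric_unit (Ua _ Ux)); rewrite g0 eqxx.
Qed.

Lemma einstein_constant_scalar_curvature : (3 <= n)%N -> einstein g ->
  exists S, constant_scalar_curvature g S.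
Proof.
move=> n3 E.
have n0 : (0 < n)%N by exact: leq_trans n3.
have nR : n%:R != 0 :> R by rewrite pnatr_eq0 -lt0n.
have inv a b p : dom a p -> dom b p ->
    scalar_curvature (g a) (chart a p) = scalar_curvature (g b) (chart b p).
  move=> ap bp; apply: (mulIf (invr_neq0 nR)).
  exact: (@einstein_factor_change (fun c x => scalar_curvature (g c) x / n%:R)).
(* A connected space may be empty here; any constant then qualifies. *)
have [p0|noM] := pselect (exists p : M, True); last first.
  by exists 0 => a x [p ap _]; exfalso; apply: noM; exists p.
have {p0}[p0 _] := p0.
(* The chartwise values of [S / n] are glued by choosing a chart at each point; [inv] makes the
   choice harmless. *)
have [s sP] : exists s : M -> R, forall a p, dom a p ->
    scalar_curvature (g a) (chart a p) / n%:R = s p.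
  pose idx_of p := cid (dom_cover X p).
  exists (fun p => scalar_curvature (g (sval (idx_of p)))
                     (chart (sval (idx_of p)) p) / n%:R) => a p ap.
  exact: (congr1 (fun z => z / n%:R) (inv _ _ _ ap (svalP (idx_of p)))).
have sE a x : crange a x -> scalar_curvature (g a) x / n%:R = in_chart a s x.
  by move=> [p ap <-]; rewrite (in_chartE s ap); exact: sP.
have ss a : smooth_on (crange a) (fun x => scalar_curvature (g a) x / n%:R).
  apply: (einstein_factor_smooth (@crange_open a) (@metric_mxsmooth a)
    (fun x bx => metric_unit bx) (E a) (Ordinal n0)).
have sconst := chart_constant (F := s) _ _.
exists (n%:R * s p0) => a _ [p ap <-].
apply: (mulIf (invr_neq0 nR)); rewrite mulrAC divff// mul1r.
rewrite sP//; apply: sconst => c x.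
  move=> cx; apply: (eq_on_differentiable (@crange_open c) cx); last first.
    exact: smooth_on_differentiable (ss c) cx.
  by move=> z; rewrite inE => /sE.
move=> i cx; rewrite -(eq_on_pd i (@crange_open c) cx
  (F := fun x => scalar_curvature (g c) x / n%:R)); last first.
  by move=> z; rewrite inE => /sE.
have := schur_chart (@crange_open c) (@metric_mxsmooth c)
  (fun x bx => Defs.metric_sym g bx) (fun x bx => metric_unit bx) (E c) i cx.
move/eqP; rewrite -subr_eq0 -mulrBl mulf_eq0 => /orP[|/eqP //].
by rewrite subr_eq0 eqr_nat => /eqP n2; rewrite n2 in n3.
Qed.

End Globalization.

Theorem lemma1 (R : realType) (n : nat) (M : topologicalType)
    (X : smooth_manifold R n M) (g : riemannian_metric X)
    (f lambda : M -> R) (alpha beta mu rho : R) :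
  (3 <= n)%N ->
  gradient_einstein_type g alpha beta mu rho f lambda ->
  nonconstant f ->
  beta != 0 -> mu != 0 ->
  einstein g ->
  let u := fun p : M => expR (mu / beta * f p) in
  (forall p, 0 < u p) /\
  exists S c : R,
    constant_scalar_curvature g S /\
    special_concircular g u (S / (n%:R * (n%:R - 1))) (mu / beta * c).
Proof.
move=> n3 [f_smooth l_smooth _ eqn] f_nc beta0 mu0 E u.
split=> [p|]; first exact: expR_gt0.
have [S HS] := einstein_constant_scalar_curvature n3 E.
have nR : n%:R != 0 :> R by rewrite pnatr_eq0 -lt0n (leq_trans _ n3).
have n1R : n%:R - 1 != 0 :> R.
  by rewrite subr_eq0 pnatr_eq1; case: n n3 {X g f lambda u f_smooth l_smooth eqn f_nc E HS nR} => [|[]].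
pose r := mu / beta; have r0 : r != 0 by rewrite mulf_neq0 ?invr_neq0.
pose k := S / (n%:R * (n%:R - 1)).
(* The factor [r * u] comes from [hessian_exp_scale]; the rest is the structure equation, with the
   Ricci term moved to the right, divided by [beta]. *)
pose psi p := r * u p * (beta^-1 * (rho * S + lambda p - alpha * (S / n%:R))).
have uE a : in_chart a u = fun x => expR (r * in_chart a f x) by [].
have u_smooth : smooth X u.
  by move=> a; rewrite uE; apply: smooth_exp_scale => //; exact: crange_open.
have psi_smooth : smooth X psi.
  move=> a; have oa := @crange_open _ _ _ X a.
  have sc (c : R) : smooth_on (crange a) (fun=> c) by exact: smooth_on_cst.
  apply: (smooth_onM oa); first by apply: (smooth_onM oa) => //; exact: u_smooth.
  apply: (smooth_onM oa) => //; apply: (smooth_onB oa) => //.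
  by apply: (smooth_onD oa) => //; exact: l_smooth.
have hess_u (a : idx X) p : dom a p ->
    hessian (g a) (in_chart a u) (chart a p) = psi p *: g a (chart a p).
  move=> ap; have ax : crange a (chart a p) by exists p.
  rewrite uE (hessian_exp_scale _ _ (@crange_open _ _ _ X a) (f_smooth a) ax).
  have := eqn a p ap; rewrite /= (E _ _ ax) (HS _ _ ax) => e.
  rewrite (in_chartE f ap) -/(u p).
  move: (hessian _ _ _) (_^T *m _) (g a _) e => H T G e.
  have -> : H + r *: T = (beta^-1 * (rho * S + lambda p - alpha * (S / n%:R))) *: G.
    apply: (scalerI beta0); rewrite scalerA mulVKf// scalerBl -e (scalerA alpha).
    have br : beta * r = mu by rewrite /r mulrC divfK.
    by rewrite scalerDr (scalerA beta r) br -(addrA _ (beta *: H)) [RHS]addrC addKr.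
  by rewrite scalerA.
have dpsi (a : idx X) x i : crange a x ->
    pd i (in_chart a psi) x = - k * pd i (in_chart a u) x.
  move=> ax; have := @concircular_chart _ _ (crange a) (g a) (@crange_open _ _ _ X a)
    (@metric_mxsmooth _ _ _ X g a) (fun x bx => Defs.metric_sym g bx)
    (fun x bx => metric_unit g bx) (fun=> S / n%:R) _ (in_chart a u) (in_chart a psi)
    (u_smooth a) (psi_smooth a) _ i x ax.
  move=> H; apply: (mulfI n1R); rewrite H.
  - by rewrite /k; move: (pd _ _ _) => d; field; rewrite nR n1R.
  - by move=> z az; rewrite (E _ _ az) (HS _ _ az).
  - by move=> _ [p ap <-]; rewrite hess_u// (in_chartE psi ap).
(* A first integral: [dpsi] makes its differential vanish, and its value is the coefficient [b]. *)
pose h p := psi p + k * u p.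
have h_const : forall p q, h p = h q.
  have du (a : idx X) x : crange a x -> differentiable (in_chart a u) x.
    by move=> ax; exact: (smooth_on_differentiable (u_smooth a) ax).
  have dp (a : idx X) x : crange a x -> differentiable (in_chart a psi) x.
    by move=> ax; exact: (smooth_on_differentiable (psi_smooth a) ax).
  have dk (a : idx X) x : crange a x -> differentiable (fun z => k * in_chart a u z) x.
    by move=> ax; apply: differentiableM; [exact: differentiable_cst|exact: du].
  have hE a : in_chart a h = fun z => in_chart a psi z + k * in_chart a u z by [].
  apply: (@chart_constant _ _ _ X) => a x; rewrite hE.
    by move=> ax; apply: differentiableD; [exact: dp|exact: dk].
  move=> i ax; rewrite pdD; [|exact: dp|exact: dk].
  rewrite pdM; [|exact: differentiable_cst|exact: du].
  by rewrite pd_cst mul0r add0r dpsi// mulNr addNr.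
(* On an empty [M] every function would be constant, contrary to [f_nc]. *)
have [p0 _] : exists p : M, True.
  have [//|noM] := pselect (exists p : M, True).
  by case: f_nc; exists 0 => p; case: noM; exists p.
(* The factor [r^-1] makes [mu / beta * c] equal to the constant [h p0]. *)
exists S, (r^-1 * h p0); split=> //; split=> //.
- move=> [c uc]; apply: f_nc; exists (f p0) => p; apply: (mulfI r0).
  by apply: expR_inj; have := uc p; rewrite -(uc p0).
- move=> a p ap; rewrite hess_u// -/r -/k mulVKf// (h_const p0 p) /h.
  by congr (_ *: _); rewrite mulNr addrC addrK.
Qed.
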